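(* Let $n\ge 2$ and let $(M;E,V)$ be the semi-integrable Legendrian contact structure given, in coordinates $(x^i,u,p_i)$, $1\le i\le n$, by $$E=\mathrm{span}\{\partial_{x^i}+p_i\partial_u+f_{ij}\partial_{p_j}\},\qquad V=\mathrm{span}\{\partial_{p_i}\},\qquad f_{ij}=f_{ji}=f_{ij}(x,u,p).$$ Let $(\mathcal G\to M,\omega)$ be the associated regular, normal parabolic geometry, and let $s:M\to\mathcal G$ be a (local) section such that $$\omega^{n+1}{}_0=\sigma,\quad \omega^i{}_0=\theta^i,\quad \omega^{n+1}{}_i=\pi_i,\quad \omega^0{}_0\equiv 0\ \bmod\{\theta^i,\pi_i\},$$ where $s^*\omega=\omega^a{}_bE_a{}^b$, $\theta^i=dx^i$, $\pi_i=dp_i-f_{ij}dx^j$, $\sigma=du-p_idx^i$. Then with respect to $s$ the $\mathbb W$-component of the harmonic curvature is $$W^l{}_k{}^i{}_j\; E_0{}^k\wedge E_l{}^{n+1}\otimes\left(E_i{}^j-\delta_i{}^jE_{n+1}{}^{n+1}\right),$$ where $W^l{}_k{}^i{}_j$ is the trace-free part of the tensor $$T^l{}_k{}^i{}_j=-\frac{\partial^2 f_{kj}}{\partial p_l\,\partial p_i}.$$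
   Context: Everything is complex analytic; summation over repeated indices; $1\le i,j,k,l\le n$ and $0\le a,b\le n+1$. A Legendrian contact (LC) structure is a splitting $C=E\oplus F$ of a contact distribution $C=\ker\sigma$ on a $(2n+1)$-manifold into rank $n$ subdistributions with $d\sigma|_E=d\sigma|_F=0$; it is semi-integrable if one of $E,F$ is Frobenius integrable (here $F=V$ is). Lie algebra: $G=\mathrm{SL}(n+2,\mathbb C)$, $\mathfrak g=\mathfrak{sl}_{n+2}$; $E_a{}^b$ is the matrix with $1$ in row $a$, column $b$ and $0$ elsewhere (rows and columns numbered $0,\dots,n+1$). $P\subset G$ is the subgroup of block upper triangular matrices for block sizes $(1,n,1)$, with Lie algebra $\mathfrak p=\mathfrak g_0\oplus\mathfrak g_1\oplus\mathfrak g_2$, where $\mathfrak g=\mathfrak g_{-2}\oplus\cdots\oplus\mathfrak g_2$ is the contact grading: $\mathfrak g_0$ is block diagonal, $\mathfrak g_{-1}=\mathrm{span}\{E_i{}^0,E_{n+1}{}^i\}$, $\mathfrak g_{-2}=\mathrm{span}\{E_{n+1}{}^0\}$, $\mathfrak g_1=\mathrm{span}\{E_0{}^i,E_i{}^{n+1}\}$, $\mathfrak g_2=\mathrm{span}\{E_0{}^{n+1}\}$, $\mathfrak p_+=\mathfrak g_1\oplus\mathfrak g_2$, $\mathfrak g_-=\mathfrak g_{-2}\oplus\mathfrak g_{-1}$. Parabolic geometry: a Cartan geometry $(\mathcal G\to M,\omega)$ of type $(G,P)$ has curvature $K=d\omega+\frac12[\omega,\omega]$, i.e. $K^a{}_b=d\omega^a{}_b+\omega^a{}_c\wedge\omega^c{}_b$,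 equivalently a $P$-equivariant curvature function $\kappa:\mathcal G\to\bigwedge^2(\mathfrak g/\mathfrak p)^*\otimes\mathfrak g\cong\bigwedge^2\mathfrak p_+\otimes\mathfrak g$. The identification $(\mathfrak g/\mathfrak p)^*\cong\mathfrak p_+$ is the one induced by the form $B(X,Y)=\mathrm{tr}(XY)$; after pulling back by $s$ it reads $\theta^j\leftrightarrow E_0{}^j$, $\pi_j\leftrightarrow E_j{}^{n+1}$, $\sigma\leftrightarrow E_0{}^{n+1}$. The geometry is regular if $\kappa$ takes values in positive homogeneities (for the grading element), and normal if $\partial^*\kappa=0$, where $\partial^*$ is the Lie algebra homology differential, $\partial^*(X\wedge Y\otimes v)=-Y\otimes[X,v]+X\otimes[Y,v]-[X,Y]\otimes v$ on $\bigwedge^2\mathfrak p_+\otimes\mathfrak g$. LC structures are equivalent (as a category) to regular, normal parabolic geometries of this type, with $E$ and $F$ corresponding respectively to the $P$-submodules of $\mathfrak g/\mathfrak p$ spanned by the $E_i{}^0$ and by the $E_{n+1}{}^i$. Harmonic curvature: $\kappa_H:\mathcal G\to\ker(\partial^* )/\mathrm{im}(\partial^* )$ is the class of $\kappa$. As a $\mathfrak g_0$-module $\ker(\partial^* )/\mathrm{im}(\partial^* )\cong H^2(\mathfrak g_-,\mathfrak g)=\mathbb W\oplus\mathbb T_1\oplus\mathbb T_2$ (irreducible summands of homogeneities $+2,+1,+1$), where $\mathbb W$ is realized as the $\mathfrak g_0$-submodule of $\bigwedge^2\mathfrak p_+\otimes\mathfrak g$ with lowest weight vector $E_0{}^1\wedge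 E_n{}^{n+1}\otimes E_n{}^1$; it consists of the tensors $W^l{}_k{}^i{}_j\,E_0{}^k\wedge E_l{}^{n+1}\otimes(E_i{}^j-\delta_i{}^jE_{n+1}{}^{n+1})$ with $W^l{}_k{}^i{}_j$ symmetric in $(i,l)$, symmetric in $(j,k)$ and trace-free in $(i,j)$. Trace-free part: with $T^l{}_j=T^i{}_i{}^l{}_j$ and $T=T^i{}_i{}^j{}_j$, the trace-free part of $T^l{}_k{}^i{}_j$ is $$T^l{}_k{}^i{}_j-\tfrac1{n+2}\left(\delta^i{}_jT^l{}_k+\delta^l{}_kT^i{}_j+\delta^l{}_jT^i{}_k+\delta^i{}_kT^l{}_j\right)+\tfrac1{(n+2)(n+1)}\left(\delta^l{}_k\delta^i{}_j+\delta^l{}_j\delta^i{}_k\right)T.$$ *)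

(* Defs.v *)
From HB Require Import structures.
From mathcomp Require Import all_boot all_order all_algebra.
From mathcomp Require Import all_classical all_reals all_analysis complex.

Set Implicit Arguments.
Unset Strict Implicit.
Unset Printing Implicit Defensive.

Import Order.TTheory GRing.Theory Num.Theory numFieldNormedType.Exports.
Local Open Scope classical_set_scope.
Local Open Scope ring_scope.

(* [R[i]] seen as a numFieldType, so that its own modulus topology, and
   differentiability over the complex field, are the ones that are inferred. *)
Definition Cx (R : realType) : numFieldType := R[i].

(* n + (1 + n) plays two roles: it indexes the coordinates (x^i, u, p_i) of
   M, and the basis (E_i^0, E_{n+1}^0, E_{n+1}^i) of g_- ~ g/p. *)
Definition dimM (n : nat) : nat := (n + (1 + n))%N.

Definition ptM (R : realType) (n : nat) := 'rV[Cx R]_(dimM n).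
Definition mat (R : realType) (n : nat) := 'M[Cx R]_n.+2.

Section Indices.
Variable n : nat.

Definition ix (i : 'I_n) : 'I_(dimM n) := lshift (1 + n)%N i.
Definition iu : 'I_(dimM n) := rshift n (lshift n (ord0 : 'I_1)).
Definition ip (i : 'I_n) : 'I_(dimM n) := rshift n (rshift 1%N i).

(* the middle indices 1, ..., n among 0, ..., n + 1 *)
Definition mid (i : 'I_n) : 'I_n.+2 := lift ord0 (widen_ord (leqnSn n) i).
Definition top : 'I_n.+2 := ord0.
Definition bot : 'I_n.+2 := ord_max.

(* number of the block containing a, for block sizes (1, n, 1); the matrix
   unit E_a^b lies in g_(blk b - blk a) *)
Definition blk (a : 'I_n.+2) : nat :=
  (if a == top then 0 else if a == bot then 2 else 1)%N.

End Indices.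

Arguments iu {n}.
Arguments top {n}.
Arguments bot {n}.

Section Calculus.
Variables (R : realType) (n : nat).
Local Notation C := (Cx R).
Local Notation pt := (ptM R n).

(* Complex analytic: complex differentiable on the open set U, together with
   all iterated complex derivatives (automatic by Cauchy's theorem). *)
Definition holomorphic_on (U : set pt) (f : pt -> C) : Prop :=
  forall (vs : seq pt) (x : pt), U x ->
    differentiable (foldr (fun v (g : pt -> C) => 'D_v g) f vs) x.

Definition mx_holomorphic_on (U : set pt) (F : pt -> mat R n) : Prop :=
  forall a b, holomorphic_on U (fun x => F x a b).

Definition mx_deriv (F : pt -> mat R n) (v x : pt) : mat R n :=
  \matrix_(a, b) 'D_v (fun y => F y a b : C) x.

(* the coordinate vector field of the coordinate of index m *)
Definition dd (m : 'I_(dimM n)) : pt := delta_mx ord0 m.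

End Calculus.

Section LCStructure.
Variables (R : realType) (n : nat).
Local Notation C := (Cx R).
Local Notation pt := (ptM R n).
Variable f : 'I_n -> 'I_n -> pt -> C.

(* fibres at x of E and V, as row spaces *)
Definition Edist (x : pt) : 'M[C]_(n, dimM n) :=
  \matrix_(i < n) (dd R (ix i) + x ord0 (ip i) *: dd R iu
                   + \sum_(j < n) f i j x *: dd R (ip j)).

Definition Vdist : 'M[C]_(n, dimM n) := \matrix_(i < n) dd R (ip i).

Definition theta (i : 'I_n) (v : pt) : C := v ord0 (ix i).
Definition pi_ (i : 'I_n) (x v : pt) : C :=
  v ord0 (ip i) - \sum_(j < n) f i j x * v ord0 (ix j).
Definition sigma (x v : pt) : C :=
  v ord0 iu - \sum_(i < n) x ord0 (ip i) * v ord0 (ix i).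

End LCStructure.

Section LieAlgebra.
Variables (R : realType) (n : nat).
Local Notation C := (Cx R).
Local Notation M := (mat R n).

Definition E (a b : 'I_n.+2) : M := delta_mx a b.
Definition lie (X Y : M) : M := X *m Y - Y *m X.
Definition Bform (X Y : M) : C := \tr (X *m Y).

Definition block_upper (X : M) : Prop :=
  forall a b : 'I_n.+2, (blk b < blk a)%N -> X a b = 0.

Definition in_g (X : M) : Prop := \tr X = 0.
Definition in_p (X : M) : Prop := in_g X /\ block_upper X.
Definition in_P (h : M) : Prop := \det h = 1 /\ block_upper h.

(* basis of g_-, and basis of p_+ dual to it under Bform *)
Definition em (k : 'I_(dimM n)) : M :=
  match fintype.split k with
  | inl i => E (mid i) top
  | inr r => match fintype.split r with
             | inl _ => E bot top
             | inr i => E bot (mid i)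
             end
  end.

Definition ep (k : 'I_(dimM n)) : M :=
  match fintype.split k with
  | inl i => E top (mid i)
  | inr r => match fintype.split r with
             | inl _ => E top bot
             | inr i => E (mid i) bot
             end
  end.

Definition wt (k : 'I_(dimM n)) : nat := (if k == iu then 2 else 1)%N.

(* A chain in Lambda^r p_+ (x) g, i.e. an alternating form on g/p with values
   in g, is given by its values on the basis em of g/p; equivalently, these
   are the coefficients of the products ep k /\ ep l /\ ... *)
Definition chain1 := 'I_(dimM n) -> M.
Definition chain2 := 'I_(dimM n) -> 'I_(dimM n) -> M.
Definition chain3 := 'I_(dimM n) -> 'I_(dimM n) -> 'I_(dimM n) -> M.

(* X (x) v and X /\ Y (x) v, for X, Y in p_+ *)
Definition tens1 (X v : M) : chain1 := fun k => Bform X (em k) *: v.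
Definition tens2 (X Y v : M) : chain2 := fun k l =>
  (Bform X (em k) * Bform Y (em l) - Bform X (em l) * Bform Y (em k)) *: v.

(* the homology differential on decomposable chains of degrees 2 and 3 *)
Definition bdry2_dec (X Y v : M) : chain1 := fun k =>
  - tens1 Y (lie X v) k + tens1 X (lie Y v) k - tens1 (lie X Y) v k.

Definition bdry3_dec (X Y Z v : M) : chain2 := fun k l =>
  - tens2 Y Z (lie X v) k l + tens2 X Z (lie Y v) k l
  - tens2 X Y (lie Z v) k l
  - tens2 (lie X Y) Z v k l + tens2 (lie X Z) Y v k l
  - tens2 (lie Y Z) X v k l.

(* Linear extensions: an alternating c is the sum over k < l (< m) of the
   chains ep k /\ ep l (/\ ep m) (x) c k l (m); the other values of c are
   determined by these and are not used. *)
Definition bdry2 (c : chain2) : chain1 := fun q =>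
  \sum_(k < dimM n) \sum_(l < dimM n | (k < l)%N)
    bdry2_dec (ep k) (ep l) (c k l) q.

Definition bdry3 (c : chain3) : chain2 := fun q r =>
  \sum_(k < dimM n) \sum_(l < dimM n | (k < l)%N)
    \sum_(m < dimM n | (l < m)%N)
      bdry3_dec (ep k) (ep l) (ep m) (c k l m) q r.

(* equality in ker(bdry2) / im(bdry3) *)
Definition homologous (c c' : chain2) : Prop :=
  exists2 e : chain3, (forall k l m, in_g (e k l m)) &
    forall k l, c k l - c' k l = bdry3 e k l.

(* homogeneity of ep k /\ ep l (x) E_a^b *)
Definition homogeneity (k l : 'I_(dimM n)) (a b : 'I_n.+2) : int :=
  (wt k)%:Z + (wt l)%:Z + (blk b)%:Z - (blk a)%:Z.

Definition hom_part (d : int) (c : chain2) : chain2 := fun k l =>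
  \matrix_(a, b) (if homogeneity k l a b == d then c k l a b else 0).

(* four-index tensors: W l k i j is W^l_k^i_j *)
Definition tensor4 := 'I_n -> 'I_n -> 'I_n -> 'I_n -> C.

Definition W_symmetries (W : tensor4) : Prop :=
  [/\ forall l k i j, W l k i j = W i k l j,
      forall l k i j, W l k i j = W l j i k &
      forall l k, \sum_(i < n) W l k i i = 0].

Definition W_chain (W : tensor4) : chain2 := fun q r =>
  \sum_(l < n) \sum_(k < n) \sum_(i < n) \sum_(j < n)
    W l k i j *: tens2 (E top (mid k)) (E (mid l) bot)
                  (E (mid i) (mid j) - (i == j)%:R *: E bot bot) q r.

(* [is_W_component c W]: the component of the class of c in the summand
   \mathbb W of ker(bdry2) / im(bdry3) = \mathbb W + T_1 + T_2 (irreducible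
   g_0-summands, n >= 2) is the element of \mathbb W with coefficients W. The differentials preserve homogeneity,
   \mathbb W is the part of homogeneity 2 of the homology and T_1 + T_2 the
   part of homogeneity 1, so the projection onto \mathbb W along T_1 + T_2
   sends the class of c to the class of its part of homogeneity 2. *)
Definition is_W_component (c : chain2) (W : tensor4) : Prop :=
  W_symmetries W /\ homologous (hom_part 2 c) (W_chain W).

Definition kron (i j : 'I_n) : C := (i == j)%:R.

Definition trace_free_part (T : tensor4) : tensor4 := fun l k i j =>
  let T1 l j := \sum_(i < n) T i i l j in
  let T0 := \sum_(i < n) \sum_(j < n) T i i j j in
  T l k i j
  - (n + 2)%N%:R^-1 * (kron i j * T1 l k + kron l k * T1 i j
                     + kron l j * T1 i k + kron i k * T1 l j)
  + ((n + 2)%N%:R * (n + 1)%N%:R)^-1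
    * (kron l k * kron i j + kron l j * kron i k) * T0.

End LieAlgebra.

Section CartanGeometry.
Variables (R : realType) (n : nat).
Local Notation C := (Cx R).
Local Notation pt := (ptM R n).
Local Notation M := (mat R n).

(* The principal P-bundle over U is U x P, with right action
   (x, h) k = (x, h k). A tangent vector at (x, h) is written (v, X), with v
   tangent to U and X in p, the component along P being h X; the action of k
   sends (v, X) to (v, k^-1 X k), and (0, X) is the value of the fundamental
   vector field of X. [omega x h v X] is the value at (x, h), on (v, X), of
   a g-valued 1-form; its restriction to U x P is the only relevant part. *)
Definition form1 := pt -> M -> pt -> M -> M.

Record cartan_connection (U : set pt) (omega : form1) : Prop := {
  cc_linear : forall x h (a : C) v w X Y, U x -> in_P h -> in_p X -> in_p Y ->
    omega x h (a *: v + w) (a *: X + Y) = a *: omega x h v X + omega x h w Y;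
  cc_values : forall x h v X, U x -> in_P h -> in_p X -> in_g (omega x h v X);
  cc_iso : forall x h Z, U x -> in_P h -> in_g Z ->
    exists! t : pt * M, in_p t.2 /\ omega x h t.1 t.2 = Z;
  cc_equivariant : forall x h k v X, U x -> in_P h -> in_P k -> in_p X ->
    omega x (h *m k) v (invmx k *m X *m k) = invmx k *m omega x h v X *m k;
  cc_fundamental : forall x h X, U x -> in_P h -> in_p X -> omega x h 0 X = X;
  (* by equivariance, omega is then holomorphic in (x, h) jointly *)
  cc_holomorphic : forall h v X, in_P h -> in_p X ->
    mx_holomorphic_on U (fun x => omega x h v X) }.

Definition omega_inv (omega : form1) (x : pt) (h Z : M) : pt * M :=
  xget (0, 0) [set t : pt * M | in_p t.2 /\ omega x h t.1 t.2 = Z].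

(* K = d omega + 1/2 [omega, omega] on the vectors (v, 0) and (w, 0) at
   (x, h); these are values of commuting vector fields on U x P. *)
Definition curvature (omega : form1) (x : pt) (h : M) (v w : pt) : M :=
  mx_deriv (fun y => omega y h w 0) v x - mx_deriv (fun y => omega y h v 0) w x
  + lie (omega x h v 0) (omega x h w 0).

(* kappa(X, Y) = K(omega^-1 X, omega^-1 Y) on the basis em of g/p. As K
   vanishes on vertical vectors, only the U-components of omega^-1 matter. *)
Definition kappa (omega : form1) (x : pt) (h : M) : chain2 R n := fun k l =>
  curvature omega x h (omega_inv omega x h (em R k)).1
                      (omega_inv omega x h (em R l)).1.

Definition is_regular (U : set pt) (omega : form1) : Prop :=
  forall x h, U x -> in_P h -> forall k l a b,
    homogeneity k l a b <= 0 -> kappa omega x h k l a b = 0.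

Definition is_normal (U : set pt) (omega : form1) : Prop :=
  forall x h, U x -> in_P h -> forall k, bdry2 (kappa omega x h) k = 0.

(* omega induces on U the distributions E and V given by the row spaces of
   Ed x and Vd x: they correspond to the submodules of g/p spanned by the
   E_i^0 and by the E_{n+1}^i *)
Definition induces_LC (U : set pt) (omega : form1)
    (Ed Vd : pt -> 'M[C]_(n, dimM n)) : Prop :=
  forall x h v, U x -> in_P h ->
    ((v <= Ed x)%MS <-> exists c : 'I_n -> C,
       in_p (omega x h v 0 - \sum_(i < n) c i *: E R (mid i) top)) /\
    ((v <= Vd x)%MS <-> exists c : 'I_n -> C,
       in_p (omega x h v 0 - \sum_(i < n) c i *: E R bot (mid i))).

(* the section x |-> (x, s x) of U x P *)
Definition is_section (U : set pt) (s : pt -> M) : Prop :=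
  (forall x, U x -> in_P (s x)) /\ mx_holomorphic_on U s.

Definition pullback (omega : form1) (s : pt -> M) (x v : pt) : M :=
  omega x (s x) v (invmx (s x) *m mx_deriv s v x).

Definition adapted (U : set pt) (f : 'I_n -> 'I_n -> pt -> C) (omega : form1)
    (s : pt -> M) : Prop :=
  forall x, U x ->
    [/\ forall v, pullback omega s x v bot top = sigma x v,
        forall i v, pullback omega s x v (mid i) top = theta i v,
        forall i v, pullback omega s x v bot (mid i) = pi_ f i x v &
        exists a b : 'I_n -> C, forall v,
          pullback omega s x v top top =
            \sum_(i < n) a i * theta i v + \sum_(i < n) b i * pi_ f i x v].

Definition T_tensor (f : 'I_n -> 'I_n -> pt -> C) (x : pt) : tensor4 R n :=
  fun l k i j => - 'D_(dd R (ip l)) ('D_(dd R (ip i)) (f k j)) x.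

End CartanGeometry.

(* Main.v *)
(** The curvature at the section s is dA + A /\ A for A = s^* omega, evaluated
    on the frame dual to (theta, sigma, pi). In homogeneity 1, normality
    determines the gl_n-block of A on this frame modulo sigma: it vanishes on
    the fields d/dp_l, and on the lift of d/dx^k it is d f_jk / d p_i plus a
    multiple of delta^i_j. Hence the coefficient of theta^k /\ pi_l in the
    gl_n-block of the curvature is T^l_k^i_j up to terms containing a Kronecker
    delta. In homogeneity 2, every cycle is, up to an explicit boundary, the
    symmetrization W of this coefficient in (i, l) and (j, k), and being a
    cycle forces W to be trace-free. Since T is already symmetric, W differs
    from T by symmetrized delta terms only, so it is the trace-free part of T. *)

Require Import Defs.
From mathcomp Require Import all_boot all_order all_algebra.
From mathcomp Require Import all_classical all_reals all_analysis complex.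
From mathcomp Require Import perm ring lra.
Import Order.TTheory GRing.Theory Num.Theory numFieldNormedType.Exports.

Set Implicit Arguments.
Unset Strict Implicit.

(** * Symmetry of second complex derivatives *)

Section Schwarz.
Local Open Scope classical_set_scope.
Local Open Scope ring_scope.
Local Open Scope complex_scope.
Variables (R : realType) (V : normedModType (Cx R)).
Local Notation C := (Cx R).

(** The coefficients of A that normality would fix in homogeneity 2, such as its entries in p_+ and
    its gl_n-block on d/du, are never solved for. In the coefficient of theta^k /\ pi_l each of them
    is multiplied by a Kronecker delta, and the vanishing trace of W determines all such terms at
    once. Only homogeneity 1 leads to linear systems that must be solved.

    The homology is treated by hand rather than through Kostant's theorem: an explicit 3-chain,
    written in terms of the coefficients of an arbitrary alternating cycle, reduces that cycle to
    its symmetrization, so the geometry enters there only as the cycle condition on [kappa].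

    The curvature function is computed on lifts whose group component is frozen, whereas A lives on
    the moving section. Comparing the two requires d(ds) = 0, that is, the symmetry of second
    complex derivatives; the same fact makes T symmetric in (i, l). It is deduced from the real mean
    value theorem. *)

Lemma is_derive_real_part (P : C -> R) (F : V -> C) (y v : V) (t : R) :
  (forall a b, P (a + b) = P a + P b) ->
  (forall (r : R) z, P ((r%:C : C) * z) = r * P z) ->
  (forall z, ((`|P z|)%:C : C) <= `|z|) ->
  differentiable F (y + (t%:C : C) *: v) ->
  is_derive t 1 (fun r : R => P (F (y + (r%:C : C) *: v)))
    (P ('D_v F (y + (t%:C : C) *: v))).
Proof.
move=> PD PZ Ple dF.
have PN a : P (- a) = - P a.
  have -> : - a = ((-1)%:C : C) * a by rewrite rmorphN1 mulN1r.
  by rewrite PZ mulN1r.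
set z := y + _ in dF *.
have /(diff_derivable (v := v)) dz := dF.
have {}dz : (fun h : C => h^-1 *: ((F \o shift z) (h *: v) - F z)) @ 0^'
    --> 'D_v F z by exact: dz.
have cv : (fun h : R => h^-1 *: (((fun r : R => P (F (y + (r%:C : C) *: v)))
    \o shift t) (h *: 1) - P (F z))) @ 0^' --> P ('D_v F z).
  apply/cvgrPdist_lt => e e0.
  have e0' : 0 < (e%:C : C) by rewrite ltcR.
  move/cvgrPdist_lt : dz => /(_ _ e0').
  rewrite !near_withinE => /nbhs_ballP [d /= d0 dP].
  (* Radii of balls over [C] are themselves elements of [C]; being positive, [d] is real. *)
  have dr : d = ((complex.Re d)%:C : C).
    by case: d d0 {dP} => a b; rewrite ltcE /= => /andP[/eqP -> _].
  have d0' : 0 < complex.Re d by move: d0; rewrite dr ltcR.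
  apply/nbhs_ballP; exists (complex.Re d) => //= h.
  rewrite /ball /= sub0r normrN => hd h0.
  have /dP : ball (0 : C) d (h%:C : C).
    rewrite /ball /= sub0r normrN dr.
    by rewrite normc_def /= expr0n addr0 sqrtr_sqr ltcR.
  have hn0 : (h%:C : C) != 0 by rewrite (_ : 0 = 0%:C) // (inj_eq (@complexI R)).
  move=> /(_ hn0); rewrite -ltcR; apply: le_lt_trans.
  apply: le_trans (Ple _); rewrite PD PN lecR.
  have -> : (h%:C : C)^-1 = (h^-1)%:C by rewrite fmorphV.
  have PZ' r (w : C) : P ((r%:C : C) *: w) = r * P w by exact: PZ.
  rewrite PZ' PD PN /z [h%:A]mulr1 rmorphD scalerDl.
  by rewrite (addrCA y).
apply: DeriveDef.
  by apply/cvg_ex; exists (P ('D_v F z)); exact: cv.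
exact: (cvg_lim _ cv).
Qed.

(** The mean value theorem fails for complex values, so the real one is applied to [P (F _)] along
    the real segment from [y] to [y + t v]; [P] stands for the real or the imaginary part. *)
Lemma mean_value_real_part (P : C -> R) (F : V -> C) (y v : V) (t M : R) (m : C) :
  (forall a b, P (a + b) = P a + P b) ->
  (forall (r : R) z, P ((r%:C : C) * z) = r * P z) ->
  (forall z, ((`|P z|)%:C : C) <= `|z|) ->
  0 < t ->
  (forall r : R, 0 <= r <= t -> differentiable F (y + (r%:C : C) *: v)) ->
  (forall r : R, 0 <= r <= t ->
     `|'D_v F (y + (r%:C : C) *: v) - m| <= (M%:C : C)) ->
  `|P (F (y + (t%:C : C) *: v) - F y - t%:C * m)| <= M * t.
Proof.
move=> PD PZ Ple t0 dF DM.
have PN a : P (- a) = - P a.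
  have -> : - a = ((-1)%:C : C) * a by rewrite rmorphN1 mulN1r.
  by rewrite PZ mulN1r.
have dP r : 0 <= r <= t -> _ := fun rt => @is_derive_real_part P F y v r PD PZ Ple (dF r rt).
have [||c] := @MVT R (fun r : R => P (F (y + (r%:C : C) *: v)))
  (fun r : R => P ('D_v F (y + (r%:C : C) *: v))) 0 t t0.
- by move=> r; rewrite in_itv /= => /andP[/ltW r0 /ltW rt]; apply: dP; rewrite r0.
- apply: derivable_within_continuous => r; rewrite in_itv /= => rt.
  by have [] := dP r rt.
rewrite in_itv /= => /andP[/ltW c0 /ltW ct].
rewrite subr0 scale0r addr0 => Pc.
rewrite PD PN PZ PD PN Pc [_ * t]mulrC -mulrBr normrM gtr0_norm // mulrC ler_pM2r //.
rewrite -PN -PD -lecR.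
by apply: le_trans (Ple _) _; apply: DM; rewrite c0.
Qed.

Lemma mean_value_complex (F : V -> C) (y v : V) (t M : R) (m : C) :
  0 < t ->
  (forall r : R, 0 <= r <= t -> differentiable F (y + (r%:C : C) *: v)) ->
  (forall r : R, 0 <= r <= t ->
     `|'D_v F (y + (r%:C : C) *: v) - m| <= (M%:C : C)) ->
  `|F (y + (t%:C : C) *: v) - F y - t%:C * m| <= ((2 * M * t)%:C : C).
Proof.
move=> t0 dF DM.
have ReP := @mean_value_real_part (@complex.Re R) F y v t M m.
have ImP := @mean_value_real_part (@complex.Im R) F y v t M m.
set z := _ - _ in ReP ImP *.
have {}ReP : `|complex.Re z| <= M * t.
  apply: ReP => //; first by case=> a b [c d].
    by move=> r [a b] /=; rewrite mul0r subr0.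
  by move=> w; apply: normc_ge_Re.
have {}ImP : `|complex.Im z| <= M * t.
  apply: ImP => //; first by case=> a b [c d].
    by move=> r [a b] /=; rewrite mul0r addr0.
  by move=> [a b] /=; rewrite normc_def lecR /= -sqrtr_sqr ler_sqrt ?addr_ge0 ?sqr_ge0 // lerDr sqr_ge0.
rewrite normc_def lecR.
apply: le_trans (_ : `|complex.Re z| + `|complex.Im z| <= _); last by lra.
rewrite -[leRHS]ger0_norm ?addr_ge0 // -[leRHS]sqrtr_sqr ler_sqrt ?sqr_ge0 //.
rewrite -[X in X + _ <= _]real_normK ?num_real // -[X in _ + X <= _]real_normK ?num_real //.
by rewrite sqrrD -addrA lerD2l lerDr mulrn_wge0 // mulr_ge0.
Qed.

Lemma differentiable_approx (g : V -> C) (x w : V) : differentiable g x ->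
  exists2 L : V -> C, 'D_w g x = L w &
    (forall (a : C) u u', L (u + a *: u') = L u + a * L u') /\
    forall e : C, 0 < e ->
    \forall u \near (0 : V), `|g (x + u) - g x - L u| <= e * `|u|.
Proof.
move=> dg; have dgw := deriveE w dg.
have := diff_locally dg => /eqaddoP.
move: ('d g x) dgw => L dgw H.
exists L; first by [].
split=> [a u u'|e e0]; first by rewrite linearD linearZ.
have := H e e0.
apply: filterS => u; rewrite [(_ - _) u](_ : _ = g (x + u) - g x - L u) //.
by rewrite -[RHS]addrA -opprD [x + u]addrC.
Qed.

Lemma derive_translate (F : V -> C) (a v y : V) :
  'D_v (fun z => F (z + a)) y = 'D_v F (y + a).
Proof.
rewrite /derive; apply: (congr1 (fun q : C -> C => lim (q @ 0^'))).
by apply/funext => h; rewrite /= addrA.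
Qed.

(** The mean value bound is applied along [v] to the difference [F (y + t w) - F y]. Its derivative
    is a difference of two values of ['D_v F] near [x], which the differential of ['D_v F] at [x]
    evaluates to [t * 'D_w ('D_v F) x] up to an error o(t). *)
Lemma second_difference (F : V -> C) (x v w : V) :
  (\forall y \near x, differentiable F y) -> differentiable ('D_v F) x ->
  forall e : R, 0 < e -> exists2 d : R, 0 < d & forall t : R, 0 < t < d ->
    `|F (x + (t%:C : C) *: v + (t%:C : C) *: w) - F (x + (t%:C : C) *: v)
      - F (x + (t%:C : C) *: w) + F x - t%:C * (t%:C * 'D_w ('D_v F) x)|
    <= ((e * t ^+ 2)%:C : C).
Proof.
move=> dF dg e e0.
set g := 'D_v F in dg *.
have [A A0 Anorm] : exists2 A : R, 0 < A & (2 * `|v| + `|w| : C) <= (A%:C : C).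
  have : 0 <= 2 * `|v| + `|w| :> C by rewrite addr_ge0 ?mulr_ge0.
  move: (2 * _ + _) => z z0.
  (* The added 1 keeps [A] positive even when [v] and [w] both vanish. *)
  exists (complex.Re z + 1); last first.
    by move: z0; case: z => a b; rewrite !lecE /= => /andP[/eqP ->]; rewrite eqxx /=; lra.
  by move: z0; case: z => a b; rewrite !lecE /= => /andP[_]; lra.
(* With this choice the bound [2 * (e' * (t * A)) * t] given by [mean_value_complex] is half of
   [e * t ^+ 2]. *)
pose e' : R := e / (4 * A).
have e'0 : 0 < e' by rewrite divr_gt0 ?mulr_gt0.
have [L dgw [Llin gL]] := @differentiable_approx g x w dg.
have := gL (e'%:C : C).
rewrite ltcR => /(_ e'0) /nbhs_ballP[d1 /= d10 d1P].
move: dF => /nbhs_ballP[d2 /= d20 d2P].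
have toR (d : C) : 0 < d -> 0 < complex.Re d /\ d = ((complex.Re d)%:C : C).
  by case: d => a b; rewrite ltcE /= => /andP[/eqP -> ?].
have [[r10 d1r] [r20 d2r]] := (toR _ d10, toR _ d20).
pose d := Num.min (complex.Re d1) (complex.Re d2) / A.
exists d; first by rewrite divr_gt0 // lt_min r10.
move=> t /andP[t0]; rewrite ltr_pdivlMr // lt_min => /andP[td1 td2].
have small r r' : 0 <= r <= t -> 0 <= r' <= t ->
    `|(r%:C : C) *: v| + `|(r%:C : C) *: v + (r'%:C : C) *: w| <= ((t * A)%:C : C).
  move=> /andP[r0 rt] /andP[r'0 r't].
  apply: le_trans (_ : (t%:C : C) * (2 * `|v| + `|w|) <= _); last first.
    by rewrite rmorphM ler_wpM2l // ler0c ltW.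
  apply: le_trans (lerD (lexx _) (ler_normD _ _)) _.
  have nr (q : R) : 0 <= q -> `|q%:C : C| = q%:C.
    by move=> q0; rewrite ger0_norm // ler0c.
  rewrite !normrZ !nr // addrA mulrDr; apply: lerD; last first.
    by rewrite ler_wpM2r // lecR.
  rewrite (_ : (t%:C : C) * (2 * `|v|) = t%:C * `|v| + t%:C * `|v|); last by ring.
  by rewrite lerD // ler_wpM2r // lecR.
have ball1 (u : V) (dd : C) : `|u| <= ((t * A)%:C : C) -> dd = (complex.Re dd)%:C ->
    t * A < complex.Re dd -> `|u| < dd.
  by move=> uA -> tdd; apply: le_lt_trans uA _; rewrite ltcR.
have small1 r : 0 <= r <= t -> `|(r%:C : C) *: v| <= ((t * A)%:C : C).
  move=> rt; apply: le_trans (small r r rt rt); by rewrite lerDl.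
have small2 r r' : 0 <= r <= t -> 0 <= r' <= t ->
    `|(r%:C : C) *: v + (r'%:C : C) *: w| <= ((t * A)%:C : C).
  by move=> rt r't; apply: le_trans (small r r' rt r't); rewrite lerDr.
have t0t : 0 <= t <= t by rewrite lexx ltW.
have diffF (u : V) : `|u| <= ((t * A)%:C : C) -> differentiable F (x + u).
  move=> /ball1 - /(_ _ d2r td2) ud; apply: d2P.
  by rewrite -ball_normE /= opprD addrA subrr sub0r normrN.
have approx (u : V) : `|u| <= ((t * A)%:C : C) ->
    `|g (x + u) - g x - L u| <= (e'%:C : C) * `|u|.
  move=> /ball1 - /(_ _ d1r td1) ud.
  have /d1P : ball (0 : V) d1 u by rewrite -ball_normE /= sub0r normrN.
  exact.
pose G := fun y => F (y + (t%:C : C) *: w) - F y.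
have dFs r : 0 <= r <= t ->
    differentiable (F \o shift ((t%:C : C) *: w)) (x + (r%:C : C) *: v).
  move=> rt; apply: differentiable_comp; first by [].
  by rewrite /= -addrA; apply: diffF; apply: small2.
have DG r : 0 <= r <= t -> 'D_v G (x + (r%:C : C) *: v) =
    g (x + (r%:C : C) *: v + (t%:C : C) *: w) - g (x + (r%:C : C) *: v).
  move=> rt; rewrite /G deriveB; first last.
  - by apply: diff_derivable; apply: diffF; apply: small1.
  - by apply: diff_derivable; apply: dFs.
  by rewrite derive_translate.
have := @mean_value_complex G x v t (e' * (t * A)) ((t%:C : C) * L w) t0.
rewrite /G !opprB !addrA => H.
rewrite dgw [X in X - t%:C * _]addrAC; apply: le_trans (H _ _) _.
- move=> r rt; apply: differentiableB; first exact: dFs.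
  by apply: diffF; apply: small1.
- move=> r rt; rewrite -/G DG // -!addrA.
  set u1 := _ + (t%:C : C) *: w; set u2 := (r%:C : C) *: v.
  have Lu : L u1 = L u2 + (t%:C : C) * L w by rewrite Llin.
  have E (p q o a b m : C) : a = b + m ->
    p + (- q - m) = (p - o - a) - (q - o - b) by move=> ->; ring.
  rewrite (E _ _ (g x) _ _ _ Lu).
  apply: le_trans (ler_normB _ _) _.
  apply: le_trans (lerD (approx _ (small2 _ _ rt t0t)) (approx _ (small1 _ rt))) _.
  rewrite -mulrDr addrC.
  have -> : ((e' * (t * A))%:C : C) = (e'%:C : C) * (t * A)%:C by rewrite -rmorphM.
  apply: ler_wpM2l; first by rewrite ler0c ltW.
  exact: small.
- rewrite lecR (_ : 2 * _ * _ = e * t ^+ 2 / 2).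
    by rewrite ler_piMr ?mulr_ge0 ?sqr_ge0 ?ltW //; lra.
  by rewrite /e'; field; rewrite gt_eqF.
Qed.

(* Both mixed derivatives are the limit of the same second difference quotient
   along real multiples of [v] and [w]. *)
Lemma derive_comm (F : V -> C) (x v w : V) :
  (\forall y \near x, differentiable F y) ->
  differentiable ('D_v F) x -> differentiable ('D_w F) x ->
  'D_w ('D_v F) x = 'D_v ('D_w F) x.
Proof.
move=> dF dv dw; set c1 : C := LHS; set c2 : C := RHS.
have bound (e : R) : 0 < e -> `|c1 - c2| <= ((e + e)%:C : C).
  move=> e0; have [d1 d10 H1] := @second_difference F x v w dF dv e e0.
  have [d2 d20 H2] := @second_difference F x w v dF dw e e0.
  pose t := Num.min d1 d2 / 2.
  have m0 : 0 < Num.min d1 d2 by rewrite lt_min d10.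
  have t0 : 0 < t by rewrite divr_gt0.
  have tm : t < Num.min d1 d2 by rewrite /t; lra.
  move: tm; rewrite lt_min => /andP[t1 t2].
  have := lerD (H2 t _) (H1 t _); rewrite t0 t1 t2 => /(_ isT isT).
  move=> /(le_trans (ler_normB _ _)).
  rewrite [x + _ *: w + _]addrAC.
  have -> (a b c d p q : C) : a - b - c + d - p - (a - c - b + d - q) = q - p by ring.
  rewrite -!mulrBr !normrM ger0_norm ?ler0c ?(ltW t0) // mulrA -rmorphM -rmorphD.
  rewrite -mulrDl -expr2 mulrC rmorphM ler_pM2r //.
  by rewrite ltcR exprn_gt0.
apply/eqP; rewrite -subr_eq0 -normr_eq0.
have : 0 <= `|c1 - c2| by [].
move: (`|_|) bound => z bound z0.
have [q zq] : exists q : R, z = (q%:C : C).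
  by case: z z0 {bound} => a b; rewrite lecE /= => /andP[/eqP -> _]; exists a.
move: bound z0; rewrite zq => bound; rewrite ler0c le_eqVlt.
case/orP => [/eqP <- //|q0].
have q4 : 0 < q / 4 by rewrite divr_gt0.
have := bound _ q4; rewrite lecR; lra.
Qed.
End Schwarz.
(** * The homology differentials on alternating chains *)

Section Homology.
Local Open Scope ring_scope.
Variables (R : realType) (n : nat).
Local Notation C := (Cx R).
Local Notation M := (mat R n).
Local Notation I := ('I_(dimM n)).
Local Notation ep := (@ep R n).
Local Notation em := (@em R n).
Local Notation E := (@E R n).
Local Notation tens1 := (@tens1 R n).
Local Notation tens2 := (@tens2 R n).

Variant block_spec : 'I_n.+2 -> Type :=
  | BlockTop : block_spec top
  | BlockMid i : block_spec (mid i)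
  | BlockBot : block_spec bot.

Lemma blockP a : block_spec a.
Proof.
case: (unliftP ord0 a) => [b ->|->]; last exact: BlockTop.
case: (unliftP ord_max b) => [i ->|->].
  have -> : lift ord0 (lift ord_max i) = mid i.
    by apply/val_inj; rewrite /= /bump /= !add1n leqNgt ltn_ord.
  exact: BlockMid.
have -> : lift ord0 ord_max = bot :> 'I_n.+2 by apply/val_inj.
exact: BlockBot.
Qed.

Lemma mid_eq (i j : 'I_n) : (mid i == mid j) = (i == j).
Proof. by rewrite -!(inj_eq val_inj) /= !/bump /= eqSS. Qed.
Lemma mid_top (i : 'I_n) : (mid i == top) = false.
Proof. by []. Qed.
Lemma top_mid (i : 'I_n) : (top == mid i) = false.
Proof. by []. Qed.
Lemma mid_bot (i : 'I_n) : (mid i == bot) = false.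
Proof. by rewrite -(inj_eq val_inj) /= /bump /= add1n eqSS ltn_eqF. Qed.
Lemma bot_mid (i : 'I_n) : (bot == mid i) = false.
Proof. by rewrite eq_sym mid_bot. Qed.
Lemma top_bot : ((top : 'I_n.+2) == bot) = false.
Proof. by []. Qed.
Lemma bot_top : ((bot : 'I_n.+2) == top) = false.
Proof. by []. Qed.
Definition block_eqE :=
  (mid_eq, mid_top, top_mid, mid_bot, bot_mid, top_bot, bot_top, eqxx).

Lemma sum_blocks (V : nmodType) (F : 'I_n.+2 -> V) :
  \sum_a F a = F top + \sum_(i < n) F (mid i) + F bot.
Proof.
rewrite big_ord_recl big_ord_recr /= addrA; congr (_ + _ + _).
by congr F; apply/val_inj.
Qed.

Variant slot_spec : I -> Type :=
  | SlotX i : slot_spec (ix i)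
  | SlotU : slot_spec iu
  | SlotP i : slot_spec (ip i).

Lemma slotP k : slot_spec k.
Proof.
rewrite -[k]splitK; case: (fintype.split k) => [i|r]; first exact: SlotX.
rewrite -[r]splitK; case: (fintype.split r) => [i|i]; last exact: SlotP.
by rewrite (ord1 i); apply: SlotU.
Qed.

Lemma sum_slots (V : nmodType) (F : I -> V) :
  \sum_k F k = \sum_(i < n) F (ix i) + F iu + \sum_(i < n) F (ip i).
Proof. by rewrite big_split_ord /= big_split_ord /= big_ord1 addrA. Qed.

Lemma ix_eq (i j : 'I_n) : (ix i == ix j) = (i == j).
Proof. by rewrite (inj_eq (@lshift_inj _ _)). Qed.
Lemma ip_eq (i j : 'I_n) : (ip i == ip j) = (i == j).
Proof. by rewrite (inj_eq (@rshift_inj _ _)) (inj_eq (@rshift_inj _ _)). Qed.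
Lemma ix_iu (i : 'I_n) : (ix i == iu) = false.
Proof. exact: eq_lrshift. Qed.
Lemma iu_ix (i : 'I_n) : (iu == ix i) = false.
Proof. exact: eq_rlshift. Qed.
Lemma ix_ip (i j : 'I_n) : (ix i == ip j) = false.
Proof. exact: eq_lrshift. Qed.
Lemma ip_ix (i j : 'I_n) : (ip i == ix j) = false.
Proof. exact: eq_rlshift. Qed.
Lemma iu_ip (i : 'I_n) : (iu == ip i) = false.
Proof. by rewrite (inj_eq (@rshift_inj _ _)) eq_lrshift. Qed.
Lemma ip_iu (i : 'I_n) : (ip i == iu) = false.
Proof. by rewrite (inj_eq (@rshift_inj _ _)) eq_rlshift. Qed.
Definition slot_eqE :=
  (ix_eq, ip_eq, ix_iu, iu_ix, ix_ip, ip_ix, iu_ip, ip_iu, eqxx).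

Lemma em_ix i : em (ix i) = E (mid i) top :> M.
Proof. by rewrite /em (unsplitK (inl i)). Qed.
Lemma em_iu : em iu = E bot top :> M.
Proof. by rewrite /em (unsplitK (inr _)) (unsplitK (inl _)). Qed.
Lemma em_ip i : em (ip i) = E bot (mid i) :> M.
Proof. by rewrite /em (unsplitK (inr _)) (unsplitK (inr _)). Qed.
Lemma ep_ix i : ep (ix i) = E top (mid i) :> M.
Proof. by rewrite /ep (unsplitK (inl i)). Qed.
Lemma ep_iu : ep iu = E top bot :> M.
Proof. by rewrite /ep (unsplitK (inr _)) (unsplitK (inl _)). Qed.
Lemma ep_ip i : ep (ip i) = E (mid i) bot :> M.
Proof. by rewrite /ep (unsplitK (inr _)) (unsplitK (inr _)). Qed.
Definition slotE := (em_ix, em_iu, em_ip, ep_ix, ep_iu, ep_ip).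

Lemma BformE (a b c d : 'I_n.+2) :
  @Bform R n (E a b) (E c d) = ((b == c) && (a == d))%:R.
Proof.
rewrite /Bform /E mul_delta_mx_cond; case: (b == c); last by rewrite mulr0n mxtrace0.
rewrite mulr1n /mxtrace (bigD1 a) //= big1 ?addr0; last first.
  by move=> i /negPf ia; rewrite mxE ia.
by rewrite mxE eqxx.
Qed.

Lemma Bform_ep_em k l : @Bform R n (ep k) (em l) = (k == l)%:R.
Proof.
by case: (slotP k) => [i||i]; case: (slotP l) => [j||j];
  rewrite !slotE BformE ?block_eqE ?slot_eqE ?andbT ?andbF.
Qed.

Lemma lieEl (a b c d : 'I_n.+2) (X : M) :
  lie (E a b) X c d = (c == a)%:R * X b d - X c a * (b == d)%:R.
Proof.
rewrite /lie !mxE; congr (_ - _).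
  rewrite (bigD1 b) //= big1 ?addr0; first by rewrite mxE eqxx andbT.
  by move=> i /negPf ib; rewrite mxE ib andbF mul0r.
rewrite (bigD1 a) //= big1 ?addr0; first by rewrite mxE eqxx eq_sym.
by move=> i /negPf ib; rewrite mxE ib mulr0.
Qed.

Lemma sum_kronl (V : lmodType C) (F : 'I_n -> V) (j : 'I_n) :
  \sum_i (i == j)%:R *: F i = F j.
Proof.
rewrite (bigD1 j) //= eqxx scale1r big1 ?addr0 // => i /negPf ->.
by rewrite scale0r.
Qed.

Lemma sumI_kron (V : lmodType C) (F : I -> V) (j : I) :
  \sum_i (i == j)%:R *: F i = F j.
Proof.
rewrite (bigD1 j) //= eqxx scale1r big1 ?addr0 // => i /negPf ->.
by rewrite scale0r.
Qed.

(** These are the structure constants of the Heisenberg algebra p_+, see [lie_ep]. *)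
Definition symplectic (k l : I) : C :=
  \sum_(i < n) (((k == ix i) && (l == ip i))%:R - ((k == ip i) && (l == ix i))%:R).

Lemma sum_kron2 (i j : 'I_n) :
  \sum_(m < n) ((i == m) && (j == m))%:R = (i == j)%:R :> C.
Proof.
rewrite (bigD1 i) //= eqxx /= big1 ?addr0 ?[j == i]eq_sym // => m /negPf mi.
by rewrite eq_sym mi.
Qed.

Lemma symplectic_xp i j : symplectic (ix i) (ip j) = (i == j)%:R.
Proof.
rewrite -sum_kron2; apply: eq_bigr => m _.
by rewrite !slot_eqE /= subr0.
Qed.

Lemma symplectic_px i j : symplectic (ip i) (ix j) = - (i == j)%:R.
Proof.
rewrite -sum_kron2 -sumrN; apply: eq_bigr => m _.
by rewrite !slot_eqE /= sub0r.
Qed.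

Lemma symplectic_xx i j : symplectic (ix i) (ix j) = 0.
Proof. by apply: big1 => m _; rewrite !slot_eqE /= !andbF subr0. Qed.
Lemma symplectic_pp i j : symplectic (ip i) (ip j) = 0.
Proof. by apply: big1 => m _; rewrite !slot_eqE /= !andbF subr0. Qed.
Lemma symplectic_ul k : symplectic iu k = 0.
Proof. by apply: big1 => m _; rewrite !slot_eqE /= subr0. Qed.
Lemma symplectic_ur k : symplectic k iu = 0.
Proof. by apply: big1 => m _; rewrite !slot_eqE /= !andbF subr0. Qed.
Definition symplecticE := (symplectic_xp, symplectic_px, symplectic_xx,
  symplectic_pp, symplectic_ul, symplectic_ur).

Lemma lie_EE (a b c d : 'I_n.+2) :
  lie (E a b) (E c d) = (b == c)%:R *: E a d - (d == a)%:R *: E c b.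
Proof. by rewrite /lie /E !mul_delta_mx_cond !scaler_nat. Qed.

Lemma lie_ep k l : lie (ep k) (ep l) = symplectic k l *: ep iu :> M.
Proof.
by case: (slotP k) => [i||i]; case: (slotP l) => [j||j];
  rewrite !slotE lie_EE !symplecticE !block_eqE ?scale0r ?subr0 ?sub0r ?scaleNr //
    eq_sym.
Qed.

Lemma symplectic_sum (V : lmodType C) (F : I -> I -> V) :
  \sum_k \sum_l symplectic k l *: F k l =
  \sum_(i < n) (F (ix i) (ip i) - F (ip i) (ix i)).
Proof.
rewrite sum_slots [\sum_l symplectic iu l *: _]big1 ?addr0; last first.
  by move=> l _; rewrite symplecticE scale0r.
rewrite sumrB -sumrN; congr (_ + _); apply: eq_bigr => i _.
  rewrite sum_slots [X in X + _ + _]big1 ?add0r; last first.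
    by move=> l _; rewrite symplecticE scale0r.
  rewrite symplecticE scale0r add0r -[RHS](sum_kronl (fun j => F (ix i) (ip j)) i).
  by apply: eq_bigr => j _; rewrite symplecticE eq_sym.
rewrite sum_slots [X in _ + _ + X]big1 ?addr0; last first.
  by move=> l _; rewrite symplecticE scale0r.
rewrite symplecticE scale0r addr0 -[F _ _](sum_kronl (fun j => F (ip i) (ix j)) i).
by rewrite -sumrN; apply: eq_bigr => j _; rewrite symplecticE eq_sym scaleNr.
Qed.

Lemma symplecticC k l : symplectic l k = - symplectic k l.
Proof.
rewrite /symplectic -sumrN; apply: eq_bigr => i _.
by rewrite opprB [(l == _) && _]andbC [(l == ip i) && _]andbC.
Qed.

(** The differentials are sums over increasing indices; doubling turns them into unrestricted sums,
    in which Kronecker deltas can be contracted. *)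
Lemma sum_ltn_symmetric (V : zmodType) (F : I -> I -> V) :
  (forall k l, F l k = F k l) -> (forall k, F k k = 0) ->
  (\sum_(k < dimM n) \sum_(l < dimM n | (k < l)%N) F k l) *+ 2 =
  \sum_k \sum_l F k l.
Proof.
move=> Fsym F0; set S := (X in X *+ 2).
have SE : S = \sum_(k < dimM n) \sum_(l < dimM n | (l < k)%N) F k l.
  rewrite /S (exchange_big_dep xpredT) //=; apply: eq_bigr => k _.
  by apply: eq_bigr => l _; exact: Fsym.
rewrite mulr2n {1}SE /S -big_split /=; apply: eq_bigr => k _.
rewrite [RHS](bigD1 k) //= F0 add0r [RHS](bigID (fun l : I => (l < k)%N)) /=.
congr (_ + _); apply: eq_bigl => l; rewrite -(inj_eq val_inj) /=;
  by case: ltngtP.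
Qed.

Lemma tens1_ep k v q : tens1 (ep k) v q = (k == q)%:R *: v.
Proof. by rewrite /tens1 Bform_ep_em. Qed.

Lemma tens2_ep k l v q r : tens2 (ep k) (ep l) v q r =
  ((k == q)%:R * (l == r)%:R - (k == r)%:R * (l == q)%:R) *: v.
Proof. by rewrite /tens2 !Bform_ep_em. Qed.

Lemma E_entry (a b a' b' : 'I_n.+2) : E a b a' b' = (a' == a)%:R * (b' == b)%:R.
Proof. by rewrite mxE -natrM mulnb. Qed.

Lemma BformZl (a : C) (X Y : M) : Bform (a *: X) Y = a * Bform X Y.
Proof. by rewrite /Bform -scalemxAl mxtraceZ. Qed.

Lemma lie0r (X : M) : lie X 0 = 0.
Proof. by rewrite /lie mulmx0 mul0mx subr0. Qed.
Lemma lieDr (X Y Z : M) : lie X (Y + Z) = lie X Y + lie X Z.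
Proof. by rewrite /lie mulmxDr mulmxDl opprD addrACA. Qed.
Lemma lieNr (X Y : M) : lie X (- Y) = - lie X Y.
Proof. by rewrite /lie mulmxN mulNmx -opprD. Qed.
Lemma lieNC (X Y : M) : lie Y X = - lie X Y.
Proof. by rewrite /lie opprB. Qed.

(** When [c] alternates, the summand of [bdry2] is symmetric in its two indices, and summing over
    all pairs contracts [c] with the basis of p_+. The bracket term contracts [c] with the
    Heisenberg form and only reaches the slot [iu], since [p_+, p_+] is spanned by [ep iu]. *)
Lemma bdry2_alternating (c : chain2 R n) q : (forall k l, c l k = - c k l) ->
  bdry2 c q = - \sum_k lie (ep k) (c k q)
              - (q == iu)%:R *: \sum_(i < n) c (ix i) (ip i).
Proof.
move=> calt.
have two (X Y : M) : X *+ 2 = Y *+ 2 -> X = Y.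
  move/matrixP => XY; apply/matrixP => a b; have := XY a b.
  by rewrite !mxE -!mulr2n => /eqP; rewrite eqr_pMn2r // => /eqP.
have c0 k : c k k = 0.
  by apply: two; rewrite mul0rn mulr2n {1}calt addNr.
pose F k l := bdry2_dec (ep k) (ep l) (c k l) q.
have FE k l : F k l = - ((l == q)%:R *: lie (ep k) (c k l))
    - (k == q)%:R *: lie (ep l) (c l k) - symplectic k l *: ((q == iu)%:R *: c k l).
  rewrite /F /bdry2_dec !tens1_ep /tens1 lie_ep BformZl Bform_ep_em -scalerA.
  by rewrite (calt k l) !lieNr !scalerN opprK [iu == q]eq_sym.
have Fsym k l : F l k = F k l.
  rewrite !FE symplecticC (calt k l) scaleNr !scalerN opprK.
  have swap (X Y Z : M) : - X - Y - Z = - Y - X - Z by rewrite [- X - Y]addrC.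
  exact: swap.
have F0 k : F k k = 0 by rewrite FE c0 /lie !mulmx0 mul0mx subr0 !scaler0 !subr0 oppr0.
apply: two; rewrite [LHS](sum_ltn_symmetric Fsym F0); set rhs := RHS.
under eq_bigr do under eq_bigr do rewrite FE.
under eq_bigr do rewrite !sumrB sumrN.
rewrite !sumrB sumrN symplectic_sum.
rewrite [X in - X - _ - _](_ : _ = \sum_k lie (ep k) (c k q)); last first.
  by apply: eq_bigr => k _; rewrite (sumI_kron (fun l => lie (ep k) (c k l))).
rewrite exchange_big [X in _ - X - _](_ : _ = \sum_k lie (ep k) (c k q)); last first.
  by apply: eq_bigr => k _; rewrite (sumI_kron (fun l => lie (ep k) (c k l))).
have double (X Y Z : M) : Z = Y *+ 2 -> - X - X - Z = (- X - Y) *+ 2.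
  by move=> ->; rewrite mulrnBl [- X *+ 2]mulr2n.
rewrite {}/rhs; apply: double.
rewrite scaler_sumr -sumrMnl; apply: eq_bigr => i _.
by rewrite (calt (ix i)) scalerN opprK mulr2n.
Qed.

Lemma tens2C (X Y v : M) q r : tens2 Y X v q r = - tens2 X Y v q r.
Proof.
have H (a b c d e : C) : (a * b - c * d) * e = - ((d * c - b * a) * e) by ring.
by rewrite /tens2; apply/matrixP => a b; rewrite !mxE H.
Qed.

Lemma tens2Nl (X Y v : M) q r : tens2 (- X) Y v q r = - tens2 X Y v q r.
Proof.
have H (a b c d e : C) : (- a * b - - c * d) * e = - ((a * b - c * d) * e) by ring.
have BN (Z : M) : Bform (- X) Z = - Bform X Z by rewrite /Bform mulNmx raddfN.
by rewrite /tens2 !BN; apply/matrixP => a b; rewrite !mxE H.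
Qed.

Lemma tens2D (X Y v w : M) q r : tens2 X Y (v + w) q r = tens2 X Y v q r + tens2 X Y w q r.
Proof. by rewrite /tens2 scalerDr. Qed.

Lemma tens2Zl (x : C) (X Y v : M) q r : tens2 (x *: X) Y v q r = x *: tens2 X Y v q r.
Proof.
have H (a b c d e : C) : (x * a * b - x * c * d) * e = x * ((a * b - c * d) * e) by ring.
by rewrite /tens2 !BformZl; apply/matrixP => a b; rewrite !mxE H.
Qed.

Local Opaque lie Defs.tens2 Bform Defs.E Defs.ep Defs.em ix iu ip mid top bot.

Lemma bdry3_decC12 (X Y Z v : M) q r :
  bdry3_dec Y X Z v q r = - bdry3_dec X Y Z v q r.
Proof.
rewrite /bdry3_dec (tens2C X Y) (lieNC X Y) tens2Nl.
have H (a b c d e f : M) : - a + b - - c - - d + e - f = - (- b + a - c - d + f - e).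
  by apply/matrixP => i j; rewrite !mxE; ring.
exact: H.
Qed.

Lemma bdry3_decC23 (X Y Z v : M) q r :
  bdry3_dec X Z Y v q r = - bdry3_dec X Y Z v q r.
Proof.
rewrite /bdry3_dec (tens2C Y Z) (lieNC Y Z) tens2Nl.
have H (a b c d e f : M) : - - a + b - c - d + e - - f = - (- a + c - b - e + d - f).
  by apply/matrixP => i j; rewrite !mxE; ring.
exact: H.
Qed.

(** * The image of the differential on 3-chains *)

Definition in_image (d : chain2 R n) : Prop :=
  exists2 e : chain3 R n, (forall k l m, in_g (e k l m)) &
    forall k l, d k l = bdry3 e k l.

Lemma bdry3_decD (X Y Z v w : M) q r :
  bdry3_dec X Y Z (v + w) q r = bdry3_dec X Y Z v q r + bdry3_dec X Y Z w q r.
Proof.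
have E (a b c d e f a' b' c' d' e' f' : M) :
  - (a + a') + (b + b') - (c + c') - (d + d') + (e + e') - (f + f') =
  - a + b - c - d + e - f + (- a' + b' - c' - d' + e' - f').
  by apply/matrixP => i j; rewrite !mxE; ring.
rewrite /bdry3_dec.
rewrite (lieDr X) (lieDr Y) (lieDr Z).
rewrite (tens2D Y Z (lie X v)) (tens2D X Z (lie Y v)) (tens2D X Y (lie Z v)).
rewrite (tens2D (lie X Y) Z v) (tens2D (lie X Z) Y v) (tens2D (lie Y Z) X v).
exact: E.
Qed.

Lemma bdry3_dec0 (X Y Z : M) q r : bdry3_dec X Y Z 0 q r = 0.
Proof. by apply: (addIr (bdry3_dec X Y Z 0 q r)); rewrite -bdry3_decD !addr0 add0r. Qed.

Lemma bdry3_decN (X Y Z v : M) q r :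
  bdry3_dec X Y Z (- v) q r = - bdry3_dec X Y Z v q r.
Proof.
apply: (addIr (bdry3_dec X Y Z v q r)).
by rewrite -bdry3_decD !addNr bdry3_dec0.
Qed.

Lemma in_imageD (c d : chain2 R n) :
  in_image c -> in_image d -> in_image (fun k l => c k l + d k l).
Proof.
move=> [e eg eE] [e' eg' eE']; exists (fun k l m => e k l m + e' k l m).
  by move=> k l m; rewrite /in_g mxtraceD eg eg' addr0.
move=> k l; rewrite eE eE' /bdry3 -big_split; apply: eq_bigr => q _.
rewrite -big_split; apply: eq_bigr => r _; rewrite -big_split.
by apply: eq_bigr => m _; rewrite bdry3_decD.
Qed.

Lemma in_image0 : in_image (fun _ _ => 0).
Proof.
exists (fun _ _ _ => 0); first by move=> *; rewrite /in_g mxtrace0.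
move=> k l; rewrite /bdry3 big1 // => q _; rewrite big1 // => r _.
by rewrite big1 // => m _; rewrite bdry3_dec0.
Qed.

Lemma in_image_ext (c d : chain2 R n) :
  (forall k l, c k l = d k l) -> in_image c -> in_image d.
Proof. by move=> cd [e eg eE]; exists e => // k l; rewrite -cd. Qed.

Lemma in_imageN (d : chain2 R n) : in_image d -> in_image (fun k l => - d k l).
Proof.
move=> [e eg eE]; exists (fun k l m => - e k l m).
  by move=> k l m; rewrite /in_g raddfN /= eg oppr0.
move=> k l; rewrite eE /bdry3 -sumrN; apply: eq_bigr => q _.
rewrite -sumrN; apply: eq_bigr => r _; rewrite -sumrN.
by apply: eq_bigr => m _; rewrite bdry3_decN.
Qed.

Lemma in_image_sum (J : finType) (d : J -> chain2 R n) :
  (forall j, in_image (d j)) -> in_image (fun k l => \sum_j d j k l).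
Proof.
move=> H; rewrite /index_enum; elim: (Finite.enum J) => [|j s IH].
  by apply: in_image_ext in_image0 => k l; rewrite big_nil.
by apply: in_image_ext (in_imageD (H j) IH) => k l; rewrite big_cons.
Qed.

Lemma in_image_lt (k l m : I) (v : M) : in_g v -> (k < l)%N -> (l < m)%N ->
  in_image (bdry3_dec (ep k) (ep l) (ep m) v).
Proof.
move=> vg kl lm.
pose e : chain3 R n := fun k' l' m' => if [&& k' == k, l' == l & m' == m] then v else 0.
have ev : e k l m = v by rewrite /e !eqxx.
have e0 k' l' m' : ~~ [&& k' == k, l' == l & m' == m] -> e k' l' m' = 0.
  by rewrite /e => /negPf ->.
exists e; first by move=> k' l' m'; rewrite /e; case: ifP => // _; rewrite /in_g mxtrace0.
move=> q r; rewrite /bdry3.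
rewrite (@big_only1 _ _ _ _ k) //; last first.
  move=> k' k'k _; apply: big1 => l' _; apply: big1 => m' _.
  by rewrite e0 ?bdry3_dec0 // (negPf k'k).
rewrite (@big_only1 _ _ _ _ l) //; last first.
  move=> l' l'l _; apply: big1 => m' _.
  by rewrite e0 ?bdry3_dec0 // (negPf l'l) andbF.
rewrite (@big_only1 _ _ _ _ m) ?ev // => m' m'm _.
by rewrite e0 ?bdry3_dec0 // (negPf m'm) !andbF.
Qed.

Lemma in_imageC12 (X Y Z v : M) :
  in_image (bdry3_dec X Y Z v) -> in_image (bdry3_dec Y X Z v).
Proof. by move/in_imageN; apply: in_image_ext => k l; apply/esym/bdry3_decC12. Qed.

Lemma in_imageC23 (X Y Z v : M) :
  in_image (bdry3_dec X Y Z v) -> in_image (bdry3_dec X Z Y v).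
Proof. by move/in_imageN; apply: in_image_ext => k l; apply/esym/bdry3_decC23. Qed.

Lemma eq_oppr0 (X : M) : X = - X -> X = 0.
Proof.
move/matrixP => XX; apply/matrixP => a b; have := XX a b; rewrite !mxE => /eqP.
by rewrite -subr_eq0 opprK -mulr2n mulrn_eq0 => /eqP.
Qed.

(** [bdry3] reads strictly increasing triples only, the case of [in_image_lt]. Other triples of
    distinct indices are sorted by transpositions, each of which changes the sign, and a repeated
    index makes the value equal to its own opposite. *)
Lemma in_image_dec (k l m : I) (v : M) : in_g v ->
  in_image (bdry3_dec (ep k) (ep l) (ep m) v).
Proof.
move=> vg.
have eq12 p q : in_image (bdry3_dec (ep p) (ep p) (ep q) v).
  apply: in_image_ext in_image0 => a b.
  by apply/esym/eq_oppr0; apply: bdry3_decC12.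
have eq23 p q : in_image (bdry3_dec (ep p) (ep q) (ep q) v).
  apply: in_image_ext in_image0 => a b.
  by apply/esym/eq_oppr0; apply: bdry3_decC23.
have eq13 p q : in_image (bdry3_dec (ep p) (ep q) (ep p) v).
  by apply: in_imageC23; apply: eq12.
have [kl|lk|/val_inj ->] := ltngtP k l; last exact: eq12.
  have [lm|ml|/val_inj ->] := ltngtP l m; last exact: eq23.
    exact: in_image_lt.
  apply: in_imageC23; have [km|mk|/val_inj ->] := ltngtP k m; last exact: eq12.
    exact: in_image_lt.
  by apply: in_imageC12; apply: in_image_lt.
apply: in_imageC12; have [km|mk|/val_inj ->] := ltngtP k m; last exact: eq23.
  exact: in_image_lt.
apply: in_imageC23; have [lm|ml|/val_inj ->] := ltngtP l m; last exact: eq12.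
  exact: in_image_lt.
by apply: in_imageC12; apply: in_image_lt.
Qed.

(** There is no factor 1/6: where only one ordering of the slots is in the support of [v], the value
    of [v] is returned unchanged. *)
Definition alternation (v : chain3 R n) : chain3 R n := fun k l m =>
  v k l m + v l m k + v m k l - v l k m - v k m l - v m l k.

Lemma sum_bdry3 (J : finType) (V : zmodType) (a b c d e f : J -> V) :
  \sum_j (- a j + b j - c j - d j + e j - f j) =
  - (\sum_j a j) + \sum_j b j - \sum_j c j - \sum_j d j + \sum_j e j - \sum_j f j.
Proof. by rewrite sumrB big_split /= !sumrB big_split /= sumrN. Qed.

Lemma sum_sub_add_sub (J : finType) (V : zmodType) (a b c : J -> V) :
  - (\sum_j a j) + \sum_j b j - \sum_j c j = \sum_j (- a j + b j - c j).
Proof. by rewrite sumrB big_split /= sumrN. Qed.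

Lemma lie_alternation (X a b c d e f : M) :
  lie X (a + b + c - d - e - f) =
  - (- (lie X a - lie X e) + (lie X d - lie X c) - (lie X b - lie X f)).
Proof.
have H (a' b' c' d' e' f' : M) : a' + b' + c' - d' - e' - f' =
    - (- (a' - e') + (d' - c') - (b' - f')).
  by apply/matrixP => i j; rewrite !mxE; ring.
by rewrite 5!lieDr 3!lieNr; exact: H.
Qed.

(* Summing [bdry3_dec] over all triples of indices, instead of the increasing
   ones only, has the effect of replacing [v] by its alternation. *)
Lemma bdry3_alternation (v : chain3 R n) : (forall k l m, in_g (v k l m)) ->
  in_image (fun q r => - \sum_k lie (ep k) (alternation v k q r)
    - (q == iu)%:R *: \sum_(i < n) alternation v (ix i) (ip i) r
    + (r == iu)%:R *: \sum_(i < n) alternation v (ix i) (ip i) q).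
Proof.
move=> vg.
have := in_image_sum (fun k => in_image_sum (fun l => in_image_sum (fun m =>
  in_image_dec k l m (vg k l m)))).
apply: in_image_ext => q r.
pose L p k l m := lie (ep p) (v k l m).
pose B k l m := (q == iu)%:R *: v k l m.
have sum2 (F : I -> I -> M) :
    \sum_l \sum_m ((l == q)%:R * (m == r)%:R - (l == r)%:R * (m == q)%:R) *: F l m
    = F q r - F r q.
  under eq_bigr do under eq_bigr do rewrite scalerBl -!scalerA.
  under eq_bigr do rewrite sumrB -!scaler_sumr !sumI_kron.
  by rewrite sumrB !sumI_kron.
have S1 : \sum_k \sum_l \sum_m tens2 (ep l) (ep m) (L k k l m) q r =
    \sum_k (L k k q r - L k k r q).
  apply: eq_bigr => k _; rewrite -(sum2 (fun l m => L k k l m)).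
  by apply: eq_bigr => l _; apply: eq_bigr => m _; rewrite tens2_ep.
have S2 : \sum_k \sum_l \sum_m tens2 (ep k) (ep m) (L l k l m) q r =
    \sum_k (L k q k r - L k r k q).
  rewrite exchange_big; apply: eq_bigr => l _; rewrite -(sum2 (fun k m => L l k l m)).
  by apply: eq_bigr => k _; apply: eq_bigr => m _; rewrite tens2_ep.
have S3 : \sum_k \sum_l \sum_m tens2 (ep k) (ep l) (L m k l m) q r =
    \sum_k (L k q r k - L k r q k).
  under eq_bigr do rewrite exchange_big.
  rewrite exchange_big; apply: eq_bigr => m _; rewrite -(sum2 (fun k l => L m k l m)).
  by apply: eq_bigr => k _; apply: eq_bigr => l _; rewrite tens2_ep.
have tbr k l (w : I -> M) : \sum_m tens2 (lie (ep k) (ep l)) (ep m) (w m) q r =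
    symplectic k l *: ((q == iu)%:R *: w r - (r == iu)%:R *: w q).
  under eq_bigr do rewrite lie_ep tens2Zl tens2_ep.
  rewrite -scaler_sumr; congr (_ *: _).
  under eq_bigr do rewrite scalerBl -!scalerA.
  by rewrite sumrB -!scaler_sumr !sumI_kron ![iu == _]eq_sym.
have br (F : I -> I -> I -> M) :
    \sum_k \sum_l \sum_m tens2 (lie (ep k) (ep l)) (ep m) (F k l m) q r =
    \sum_(i < n) (((q == iu)%:R *: F (ix i) (ip i) r - (r == iu)%:R *: F (ix i) (ip i) q)
    - ((q == iu)%:R *: F (ip i) (ix i) r - (r == iu)%:R *: F (ip i) (ix i) q)).
  rewrite -(symplectic_sum (fun k l => (q == iu)%:R *: F k l r - (r == iu)%:R *: F k l q)).
  by apply: eq_bigr => k _; apply: eq_bigr => l _; rewrite tbr.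
have S4 := br (fun k l m => v k l m).
have S5 := br (fun k l m => v k m l).
have S6 := br (fun k l m => v m k l).
have X5 : \sum_k \sum_l \sum_m tens2 (lie (ep k) (ep m)) (ep l) (v k l m) q r =
    \sum_k \sum_l \sum_m tens2 (lie (ep k) (ep l)) (ep m) (v k m l) q r.
  by apply: eq_bigr => k _; rewrite exchange_big.
have X6 : \sum_k \sum_l \sum_m tens2 (lie (ep l) (ep m)) (ep k) (v k l m) q r =
    \sum_k \sum_l \sum_m tens2 (lie (ep k) (ep l)) (ep m) (v m k l) q r.
  by rewrite exchange_big; apply: eq_bigr => k _; rewrite exchange_big.
rewrite /bdry3_dec.
under eq_bigr do under eq_bigr do rewrite sum_bdry3.
under eq_bigr do rewrite sum_bdry3.
rewrite sum_bdry3.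
rewrite /L in S1 S2 S3.
rewrite [X in - X + _ - _ - _ + _ - _]S1.
rewrite [X in _ + X - _ - _ + _ - _]S2.
rewrite [X in _ - X - _ + _ - _]S3.
rewrite [X in _ - X + _ - _]S4.
rewrite [X in _ + X - _]X5.
rewrite [X in _ + X - _]S5.
rewrite [X in _ - X]X6.
rewrite [X in _ - X]S6.
have regroup (V : zmodType) (x1 x2 x3 x4 x5 x6 : V) :
    - x1 + x2 - x3 - x4 + x5 - x6 = (- x1 + x2 - x3) + (- x4 + x5 - x6).
  by rewrite !addrA.
rewrite regroup.
rewrite [X in X + _]sum_sub_add_sub [X in _ + X]sum_sub_add_sub -[RHS]addrA.
congr (_ + _).
  rewrite -sumrN; apply: eq_bigr => k _.
  by rewrite /alternation lie_alternation opprK.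
rewrite [X in - X]scaler_sumr [X in - _ + X]scaler_sumr -sumrN -big_split.
apply: eq_bigr => i _.
have H (a b : C) (x1 x2 x3 x4 x5 x6 y1 y2 y3 y4 y5 y6 : M) :
    - (a *: x1 - b *: y1 - (a *: x4 - b *: y4))
    + (a *: x5 - b *: y5 - (a *: x2 - b *: y2))
    - (a *: x3 - b *: y3 - (a *: x6 - b *: y6))
    = - (a *: (x1 + x2 + x3 - x4 - x5 - x6)) + b *: (y1 + y2 + y3 - y4 - y5 - y6).
  by apply/matrixP => i1 j1; rewrite !mxE; ring.
exact: H.
Qed.
End Homology.
(** * The homology in homogeneity 2 *)

Section Exactness.
Local Open Scope ring_scope.
Variables (R : realType) (n : nat).
Local Notation C := (Cx R).
Local Notation M := (mat R n).
Local Notation I := ('I_(dimM n)).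
Local Notation ep := (@ep R n).
Local Notation E := (@E R n).

Local Opaque lie Defs.tens2 Bform Defs.E Defs.ep Defs.em.

(** Decoded indices of the basis, which allow [primitive] to be defined by matching on three of them
    at once. *)
Variant slot := SX of 'I_n | SU | SP of 'I_n.

Definition slot_of (k : I) : slot :=
  match fintype.split k with
  | inl i => SX i
  | inr r => match fintype.split r with inl _ => SU | inr i => SP i end
  end.

Lemma slot_ix i : slot_of (ix i) = SX i.
Proof. by rewrite /slot_of (unsplitK (inl i)). Qed.
Lemma slot_iu : slot_of iu = SU.
Proof. by rewrite /slot_of (unsplitK (inr _)) (unsplitK (inl _)). Qed.
Lemma slot_ip i : slot_of (ip i) = SP i.
Proof. by rewrite /slot_of (unsplitK (inr _)) (unsplitK (inr _)). Qed.
Definition slot_ofE := (slot_ix, slot_iu, slot_ip).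

Definition block_case (T : Type) (x : T) (y : 'I_n -> T) (z : T) (a : 'I_n.+2) : T :=
  if unlift ord0 a is Some b then if unlift ord_max b is Some i then y i else z
  else x.

Lemma block_case_top T x y z : @block_case T x y z top = x.
Proof. by rewrite /block_case unlift_none. Qed.
Lemma block_case_mid T x y z i : @block_case T x y z (mid i) = y i.
Proof.
rewrite /block_case liftK (_ : widen_ord _ i = lift ord_max i) ?liftK //.
by apply/val_inj; rewrite /= /bump leqNgt ltn_ord.
Qed.
Lemma block_case_bot T x y z : @block_case T x y z bot = z.
Proof.
rewrite /block_case (_ : bot = lift ord0 ord_max) ?liftK ?unlift_none //.
exact/val_inj.
Qed.

Definition block9 (tt : C) (tm : 'I_n -> C) (tb : C)
    (mt : 'I_n -> C) (mm : 'I_n -> 'I_n -> C) (mb : 'I_n -> C)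
    (bt : C) (bm : 'I_n -> C) (bb : C) : M :=
  \matrix_(a, b) block_case (block_case tt tm tb b)
     (fun i => block_case (mt i) (mm i) (mb i) b) (block_case bt bm bb b) a.

Definition block9E := (mxE, block_case_top, block_case_mid, block_case_bot).

(** The general element of g_-. A 3-chain of homogeneity 2 takes values there: in g_(-1) on three
    slots of weight 1, and in g_(-2) when one of the slots is [iu]. *)
Definition lowmx (x y : 'I_n -> C) (z : C) : M :=
  block9 0 (fun=> 0) 0 x (fun _ _ => 0) (fun=> 0) z y 0.

Lemma in_g_lowmx x y z : in_g (lowmx x y z).
Proof.
rewrite /in_g /mxtrace sum_blocks !block9E big1 ?addr0 // => i _.
by rewrite !block9E.
Qed.

Lemma sum_mul_kron (x : 'I_n -> C) k : \sum_i x i * (i == k)%:R = x k.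
Proof.
rewrite (bigD1 k) //= eqxx mulr1 big1 ?addr0 // => i /negPf ->.
by rewrite mulr0.
Qed.
Lemma sum_kron_mul (x : 'I_n -> C) k : \sum_i (k == i)%:R * x i = x k.
Proof. by rewrite -[RHS]sum_mul_kron; apply: eq_bigr => i _; rewrite mulrC eq_sym. Qed.

Definition block_simp :=
  (mul0r, mulr0, mul1r, mulr1, subr0, sub0r, add0r, addr0, oppr0).

Lemma sum_lie_ix (x y : 'I_n -> 'I_n -> C) (z : 'I_n -> C) :
  \sum_i lie (E top (mid i)) (lowmx (x i) (y i) (z i)) =
  block9 (\sum_i x i i) (fun=> 0) 0 (fun=> 0) (fun j k => - x k j) (fun=> 0)
    0 (fun k => - z k) 0.
Proof.
apply/matrixP => a b; rewrite summxE.
case: (blockP a) => [|j|]; case: (blockP b) => [|k|]; rewrite !block9E;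
  under eq_bigr do rewrite lieEl !block_eqE !block9E ?block_simp;
  by [|rewrite big1|rewrite sumrN (sum_mul_kron (fun i => x i j))
      |rewrite sumrN sum_mul_kron].
Qed.

Lemma lie_iu (x y : 'I_n -> C) (z : C) :
  lie (E top bot) (lowmx x y z) =
  block9 z y 0 (fun=> 0) (fun _ _ => 0) (fun j => - x j) 0 (fun=> 0) (- z).
Proof.
apply/matrixP => a b; rewrite lieEl.
by case: (blockP a) => [|j|]; case: (blockP b) => [|k|];
  rewrite !block_eqE !block9E ?block_simp.
Qed.

Lemma sum_lie_ip (x y : 'I_n -> 'I_n -> C) (z : 'I_n -> C) :
  \sum_i lie (E (mid i) bot) (lowmx (x i) (y i) (z i)) =
  block9 0 (fun=> 0) 0 z (fun j k => y j k) (fun=> 0)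
    0 (fun=> 0) (- \sum_i y i i).
Proof.
apply/matrixP => a b; rewrite summxE.
case: (blockP a) => [|j|]; case: (blockP b) => [|k|]; rewrite !block9E;
  under eq_bigr do rewrite lieEl !block_eqE !block9E ?block_simp;
  by [|rewrite big1|rewrite (sum_kron_mul (fun i => y i k))
      |rewrite sum_kron_mul|rewrite sumrN].
Qed.

Variable c : chain2 R n.
Hypothesis calt : forall k l, c l k = - c k l.
Hypothesis cg : forall k l, in_g (c k l).
Hypothesis cclosed : forall k, bdry2 c k = 0.

Let B k l i j : C := c (ix k) (ip l) (mid i) (mid j).
Let Q k m l i : C := (B m l i k - B k l i m) / 2.
Let B1 k l i j : C := (B k l i j + B j l i k) / 2.
Let Q' k i l j : C := (B1 k l i j - B1 k i l j) / 2.
Let Z k l : C := - c (ix k) (ip l) top top - \sum_i Q i k l i.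
Definition Wsym l k i j : C := (B1 k l i j + B1 k i l j) / 2.

(* [Q] and [Q'] are the successive antisymmetric parts of [B] in the lower and
   in the upper indices: they are the coefficients on E_0^k /\ E_0^m /\ E_l^(n+1)
   and E_0^k /\ E_l^(n+1) /\ E_m^(n+1) whose boundary reduces [B] to [Wsym]. The
   other coefficients adjust the E_0^0 and E_(n+1)^(n+1) entries. Halves
   compensate for the alternation of an already antisymmetric family. *)
Definition primitive : chain3 R n := fun k l m =>
  match slot_of k, slot_of l, slot_of m with
  | SX k, SX m, SP l =>
      lowmx (fun i => Q k m l i / 2) (fun i => - c (ix k) (ix m) (mid l) (mid i) / 2) 0
  | SX k, SX m, SU => lowmx (fun=> 0) (fun=> 0) (- c (ix k) (ix m) top top / 2)
  | SX k, SP l, SP m =>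
      lowmx (fun i => c (ip l) (ip m) (mid i) (mid k) / 2) (fun i => Q' k l m i / 2) 0
  | SP l, SP m, SU => lowmx (fun=> 0) (fun=> 0) (c (ip l) (ip m) bot bot / 2)
  | SX k, SP l, SU => lowmx (fun=> 0) (fun=> 0) (Z k l)
  | _, _, _ => 0
  end.

Lemma in_g_primitive k l m : in_g (primitive k l m).
Proof.
by rewrite /primitive; case: (slot_of k) => *; case: (slot_of l) => *;
  case: (slot_of m) => *; first [exact: in_g_lowmx | rewrite /in_g mxtrace0].
Qed.

Definition homotopy := alternation primitive.
Local Notation e := homotopy.

Lemma alternationC12 (v : chain3 R n) k l m : alternation v l k m = - alternation v k l m.
Proof.
have H (x1 x2 x3 x4 x5 x6 : M) : x4 + x5 + x6 - x1 - x2 - x3 = - (x1 + x2 + x3 - x4 - x5 - x6).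
  by apply/matrixP => i j; rewrite !mxE; ring.
exact: H.
Qed.
Lemma alternationC23 (v : chain3 R n) k l m : alternation v k m l = - alternation v k l m.
Proof.
have H (x1 x2 x3 x4 x5 x6 : M) : x5 + x6 + x4 - x3 - x1 - x2 = - (x1 + x2 + x3 - x4 - x5 - x6).
  by apply/matrixP => i j; rewrite !mxE; ring.
exact: H.
Qed.

Lemma half (x y : C) : y = - x -> x / 2 - y / 2 = x.
Proof. by move=> ->; field. Qed.

Lemma homotopy_xxp k m l : e (ix k) (ix m) (ip l) =
  lowmx (Q k m l) (fun i => - c (ix k) (ix m) (mid l) (mid i)) 0.
Proof.
rewrite /homotopy /alternation /primitive !slot_ofE !(addr0, subr0).
apply/matrixP => a b; rewrite !mxE.
case: (blockP a) => [|i|]; case: (blockP b) => [|j|];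
  rewrite !(block_case_top, block_case_mid, block_case_bot) ?subr0 //.
  by rewrite half // /Q; field.
by rewrite half // (calt (ix k)) mxE.
Qed.

Lemma homotopy_xpp k l m : e (ix k) (ip l) (ip m) =
  lowmx (fun i => c (ip l) (ip m) (mid i) (mid k)) (Q' k l m) 0.
Proof.
rewrite /homotopy /alternation /primitive !slot_ofE !(addr0, subr0).
apply/matrixP => a b; rewrite !mxE.
case: (blockP a) => [|i|]; case: (blockP b) => [|j|];
  rewrite !(block_case_top, block_case_mid, block_case_bot) ?subr0 //.
  by rewrite half // (calt (ip l)) mxE.
by rewrite half // /Q'; field.
Qed.

Lemma homotopy_xxu k m : e (ix k) (ix m) iu =
  lowmx (fun=> 0) (fun=> 0) (- c (ix k) (ix m) top top).
Proof.
rewrite /homotopy /alternation /primitive !slot_ofE !(addr0, subr0).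
apply/matrixP => a b; rewrite !mxE.
case: (blockP a) => [|i|]; case: (blockP b) => [|j|];
  rewrite !(block_case_top, block_case_mid, block_case_bot) ?subr0 //.
by rewrite half // (calt (ix k)) mxE.
Qed.

Lemma homotopy_ppu l m : e (ip l) (ip m) iu =
  lowmx (fun=> 0) (fun=> 0) (c (ip l) (ip m) bot bot).
Proof.
rewrite /homotopy /alternation /primitive !slot_ofE !(addr0, subr0).
apply/matrixP => a b; rewrite !mxE.
case: (blockP a) => [|i|]; case: (blockP b) => [|j|];
  rewrite !(block_case_top, block_case_mid, block_case_bot) ?subr0 //.
by rewrite half // (calt (ip l)) mxE.
Qed.

Lemma homotopy_xpu k l : e (ix k) (ip l) iu = lowmx (fun=> 0) (fun=> 0) (Z k l).
Proof. by rewrite /homotopy /alternation /primitive !slot_ofE !(addr0, subr0). Qed.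

Lemma homotopy_xxx k l m : e (ix k) (ix l) (ix m) = 0.
Proof. by rewrite /homotopy /alternation /primitive !slot_ofE !(addr0, subr0). Qed.

Lemma homotopy_ppp k l m : e (ip k) (ip l) (ip m) = 0.
Proof. by rewrite /homotopy /alternation /primitive !slot_ofE !(addr0, subr0). Qed.

Lemma homotopyC12 k l m : e l k m = - e k l m.
Proof. exact: alternationC12. Qed.
Lemma homotopyC23 k l m : e k m l = - e k l m.
Proof. exact: alternationC23. Qed.
Lemma homotopy_rot k l m : e m k l = e k l m.
Proof. by rewrite homotopyC12 homotopyC23 opprK. Qed.

Local Opaque homotopy ix iu ip mid top bot.

Lemma lowmxN x y z : - lowmx x y z = lowmx (fun i => - x i) (fun i => - y i) (- z).
Proof.
apply/matrixP => a b; rewrite !mxE.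
by case: (blockP a) => [|i|]; case: (blockP b) => [|j|];
  rewrite !(block_case_top, block_case_mid, block_case_bot) ?oppr0.
Qed.

(** * The cycle condition, entry by entry *)

Lemma bdry2_entry q a b : bdry2 c q a b =
  - (\sum_(i < n) ((a == top)%:R * c (ix i) q (mid i) b
                   - c (ix i) q a top * (mid i == b)%:R)
     + ((a == top)%:R * c iu q bot b - c iu q a top * (bot == b)%:R)
     + \sum_(i < n) ((a == mid i)%:R * c (ip i) q bot b
                   - c (ip i) q a (mid i) * (bot == b)%:R))
  - (q == iu)%:R * \sum_(i < n) c (ix i) (ip i) a b.
Proof.
have H (x : C) (X1 X2 X3 Y : M) : (- (X1 + X2 + X3) - x *: Y) a b =
    - (X1 a b + X2 a b + X3 a b) - x * Y a b by rewrite !mxE.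
rewrite (bdry2_alternating q calt).
rewrite (sum_slots (fun k => lie (ep k) (c k q))).
rewrite H.
congr (- (_ + _ + _) - _ * _).
- by rewrite summxE; apply: eq_bigr => i _; rewrite slotE lieEl.
- by rewrite slotE lieEl.
- by rewrite summxE; apply: eq_bigr => i _; rewrite slotE lieEl.
- by rewrite summxE.
Qed.

Lemma c_diag k : c k k = 0.
Proof. exact: eq_oppr0. Qed.

(** Together with [closed_mid_bot] and [closed_mid_mid], this is used as the cycle condition in
    homogeneity 2: it ties the components with a slot [iu] to contractions of those without. *)
Lemma closed_top_mid q j : q != iu ->
  c iu q bot (mid j) = c (ix j) q top top - \sum_(i < n) c (ix i) q (mid i) (mid j).
Proof.
move=> /negPf qu; have /matrixP/(_ top (mid j)) := cclosed q.
rewrite bdry2_entry qu !block_eqE mxE mul0r mul1r mulr0 !subr0.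
under eq_bigr do rewrite !block_eqE mul1r.
rewrite sumrB (sum_mul_kron (fun i => c (ix i) q top top)).
under [X in _ + X]eq_bigr do rewrite !block_eqE mul0r mulr0 subr0.
rewrite [X in _ + X]big1 // addr0.
have H (a b x : C) : - (a - b + x) = 0 -> x = b - a.
  by move/eqP; rewrite oppr_eq0 addr_eq0 => /eqP/(congr1 -%R); rewrite opprB opprK.
exact: H.
Qed.

Lemma closed_mid_bot q i : q != iu ->
  c iu q (mid i) top = c (ip i) q bot bot - \sum_(m < n) c (ip m) q (mid i) (mid m).
Proof.
move=> /negPf qu; have /matrixP/(_ (mid i) bot) := cclosed q.
rewrite bdry2_entry qu !block_eqE mxE !mul0r mulr1 subr0 sub0r.
under eq_bigr do rewrite !block_eqE mul0r mulr0 subr0.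
rewrite big1 // add0r.
under eq_bigr do rewrite !block_eqE mulr1.
rewrite sumrB (sum_kron_mul (fun m => c (ip m) q bot bot)).
move=> /eqP; rewrite oppr_eq0 addrC => /eqP H.
by apply/esym/subr0_eq.
Qed.

Lemma closed_mid_mid i j :
  \sum_(m < n) c (ix m) (ip m) (mid i) (mid j) =
  c (ix j) iu (mid i) top - c (ip i) iu bot (mid j).
Proof.
have /matrixP/(_ (mid i) (mid j)) := cclosed iu.
rewrite bdry2_entry eqxx !block_eqE c_diag !mxE !mul0r mul1r subr0 addr0.
under eq_bigr do rewrite !block_eqE mul0r sub0r.
rewrite sumrN (sum_mul_kron (fun m => c (ix m) iu (mid i) top)).
under eq_bigr do rewrite !block_eqE mulr0 subr0.
rewrite (sum_kron_mul (fun m => c (ip m) iu bot (mid j))).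
by move=> /subr0_eq <-; ring.
Qed.

Lemma closed_homogeneity1 q i k : q != iu ->
  c (ix k) q (mid i) top = c (ip i) q bot (mid k).
Proof.
move=> /negPf qu; have /matrixP/(_ (mid i) (mid k)) := cclosed q.
rewrite bdry2_entry qu !block_eqE mxE ?block_simp.
under eq_bigr do rewrite !block_eqE mul0r sub0r.
rewrite sumrN (sum_mul_kron (fun m => c (ix m) q (mid i) top)).
under eq_bigr do rewrite !block_eqE mulr0 subr0.
rewrite (sum_kron_mul (fun m => c (ip m) q bot (mid k))).
by move/eqP; rewrite oppr_eq0 addrC subr_eq0 => /eqP.
Qed.

Lemma closed_homogeneity1_bot q : q != iu ->
  c iu q bot top + \sum_i c (ip i) q bot (mid i) = 0.
Proof.
move=> /negPf qu; have /matrixP/(_ bot bot) := cclosed q.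
rewrite bdry2_entry qu !block_eqE mxE ?block_simp.
under eq_bigr do rewrite !block_eqE mul0r mulr0 subr0.
rewrite big1 // add0r.
under eq_bigr do rewrite !block_eqE mul0r mulr1 sub0r.
by rewrite sumrN -opprD opprK.
Qed.

Lemma c_trace k l : c k l top top + \sum_(i < n) c k l (mid i) (mid i) + c k l bot bot = 0.
Proof. by have := cg k l; rewrite /in_g /mxtrace sum_blocks. Qed.

Lemma c_bot k l : c k l bot bot = - c k l top top - \sum_(i < n) c k l (mid i) (mid i).
Proof.
by apply/eqP; rewrite -opprD -addr_eq0 addrC c_trace.
Qed.
Lemma c_top k l : c k l top top = - c k l bot bot - \sum_(i < n) c k l (mid i) (mid i).
Proof.
by apply/eqP; rewrite -opprD -addr_eq0 [_ bot bot + _]addrC addrA c_trace.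
Qed.

(** The components with a slot [iu] are eliminated from three cycle conditions, and the corner
    entries from tr c = 0. The four contractions that remain make up four times the trace of [Wsym],
    so this is what makes [Wsym] trace-free. *)
Lemma sum_traces u w :
  \sum_(m < n) B m u m w + \sum_(m < n) B w m u m + \sum_(m < n) B m m u w
  + \sum_(m < n) B w u m m = 0.
Proof.
have H1 := @closed_top_mid (ip u) w (negbT (ip_iu u)).
have H2 := @closed_mid_bot (ix w) u (negbT (ix_iu w)).
have H3 := closed_mid_mid u w.
have H4 := c_trace (ix w) (ip u).
have E2 : \sum_(m < n) c (ip m) (ix w) (mid u) (mid m) = - \sum_(m < n) B w m u m.
  by rewrite -sumrN; apply: eq_bigr => m _; rewrite (calt (ix w)) mxE.
move: H1 H2 H3 H4; rewrite E2 (calt (ix w) iu) (calt (ip u) iu) (calt (ix w) (ip u)) !mxE.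
rewrite /B.
move: (\sum_(i < n) _) (\sum_(i < n) _) (\sum_(i < n) _) (\sum_(i < n) _) => p q r t.
move: (c _ _ _ _) (c _ _ _ _) (c _ _ _ _) (c _ _ _ _) => x1 x2 x3 x4.
move=> h1 h2 -> h4.
have -> : t = x4 + x2 by rewrite -[x2]opprK h1; ring.
have -> : r = x1 - x3 by rewrite h2; ring.
by rewrite -h4; ring.
Qed.

Lemma Wsym_symmetries : W_symmetries Wsym.
Proof.
split=> [l k i j|l k i j|l k].
- by rewrite /Wsym addrC.
- by rewrite /Wsym /B1 ![B k _ _ _ + _]addrC.
have -> : \sum_(i < n) Wsym l k i i = (\sum_(m < n) B m l m k + \sum_(m < n) B k m l m
    + \sum_(m < n) B m m l k + \sum_(m < n) B k l m m) / 4.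
  rewrite -!big_split /= mulr_suml; apply: eq_bigr => m _.
  by rewrite /Wsym /B1; field.
by rewrite sum_traces mul0r.
Qed.

Lemma Wsym_trace l k : \sum_(i < n) Wsym l k i i = 0.
Proof. by have [] := Wsym_symmetries. Qed.

Lemma W_chainE (W : tensor4 R n) q r : W_chain W q r =
  \sum_(l < n) \sum_(k < n)
    ((ix k == q)%:R * (ip l == r)%:R - (ix k == r)%:R * (ip l == q)%:R) *:
    block9 0 (fun=> 0) 0 (fun=> 0) (W l k) (fun=> 0) 0 (fun=> 0) (- \sum_i W l k i i).
Proof.
rewrite /W_chain; apply: eq_bigr => l _; apply: eq_bigr => k _.
under eq_bigr do under eq_bigr do rewrite -ep_ix -ep_ip tens2_ep scalerA mulrC -scalerA.
under eq_bigr do rewrite -scaler_sumr.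
rewrite -scaler_sumr; congr (_ *: _).
have entry i j (a b : 'I_n.+2) : (W l k i j *: (E (mid i) (mid j) - (i == j)%:R *: E bot bot)) a b
    = W l k i j * ((a == mid i)%:R * (b == mid j)%:R - (i == j)%:R * ((a == bot)%:R * (b == bot)%:R)).
  by rewrite !mxE ?E_entry -?natrM ?mulnb.
apply/matrixP => a b; rewrite summxE.
under eq_bigr do rewrite summxE.
under eq_bigr do under eq_bigr do rewrite entry.
case: (blockP a) => [|i|]; case: (blockP b) => [|j|]; rewrite !block9E;
  try by apply: big1 => i' _; apply: big1 => j' _; rewrite !block_eqE ?block_simp.
  under eq_bigr do under eq_bigr do rewrite !block_eqE ?block_simp mulrCA.
  under eq_bigr do rewrite -mulr_sumr.
  rewrite sum_kron_mul; under eq_bigr do rewrite mulrC.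
  by rewrite sum_kron_mul.
rewrite -sumrN; apply: eq_bigr => i _.
under eq_bigr do rewrite !block_eqE ?block_simp mulrN mulrC.
by rewrite sumrN sum_kron_mul.
Qed.

Lemma W_chain_xp (W : tensor4 R n) k l : W_chain W (ix k) (ip l) =
  block9 0 (fun=> 0) 0 (fun=> 0) (W l k) (fun=> 0) 0 (fun=> 0) (- \sum_i W l k i i).
Proof.
rewrite W_chainE -[RHS](sum_kronl (fun l => block9 0 (fun=> 0) 0 (fun=> 0) (W l k)
   (fun=> 0) 0 (fun=> 0) (- \sum_i W l k i i)) l).
apply: eq_bigr => l' _.
rewrite -[in RHS](sum_kronl (fun k => block9 0 (fun=> 0) 0 (fun=> 0) (W l' k)
   (fun=> 0) 0 (fun=> 0) (- \sum_i W l' k i i)) k) scaler_sumr.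
by apply: eq_bigr => k' _; rewrite !slot_eqE mul0r subr0 scalerA mulrC.
Qed.

Lemma W_chain_eq0 (W : tensor4 R n) q r :
  (forall k l, (ix k == q) && (ip l == r) = false) ->
  (forall k l, (ix k == r) && (ip l == q) = false) -> W_chain W q r = 0.
Proof.
move=> H1 H2; rewrite W_chainE big1 // => l _; rewrite big1 // => k _.
by rewrite -!natrM !mulnb H1 H2 subr0 scale0r.
Qed.

Lemma W_chainC (W : tensor4 R n) q r : W_chain W r q = - W_chain W q r.
Proof.
rewrite !W_chainE -sumrN; apply: eq_bigr => l _; rewrite -sumrN; apply: eq_bigr => k _.
by rewrite -[RHS]scaleNr opprB.
Qed.

Lemma homogeneity2 (k l : I) (a b : 'I_n.+2) :
  (homogeneity k l a b == 2) = (wt k + wt l + blk b == 2 + blk a)%N.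
Proof. by rewrite /homogeneity subr_eq -!PoszD eqz_nat. Qed.

Lemma wt_ix i : wt (ix i : I) = 1%N. Proof. by rewrite /wt slot_eqE. Qed.
Lemma wt_iu : wt (iu : I) = 2%N. Proof. by rewrite /wt slot_eqE. Qed.
Lemma wt_ip i : wt (ip i : I) = 1%N. Proof. by rewrite /wt slot_eqE. Qed.
Lemma blk_top : blk (top : 'I_n.+2) = 0%N. Proof. by []. Qed.
Lemma blk_mid i : blk (mid i : 'I_n.+2) = 1%N. Proof. by rewrite /blk !block_eqE. Qed.
Lemma blk_bot : blk (bot : 'I_n.+2) = 2%N. Proof. by rewrite /blk !block_eqE. Qed.

Lemma hom_partE d (k l : I) a b :
  hom_part d c k l a b = if homogeneity k l a b == d then c k l a b else 0.
Proof. by rewrite mxE. Qed.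
Definition homE := (hom_partE, homogeneity2, wt_ix, wt_iu, wt_ip, blk_top, blk_mid, blk_bot).

(** * Components of the boundary of [homotopy] *)

Definition bdry_x q r : M := \sum_(i < n) lie (E top (mid i)) (e (ix i) q r).
Definition bdry_u q r : M := lie (E top bot) (e iu q r).
Definition bdry_p q r : M := \sum_(i < n) lie (E (mid i) bot) (e (ip i) q r).
Definition bdry_b r : M := \sum_(i < n) e (ix i) (ip i) r.
Definition bdry_homotopy q r : M := - (bdry_x q r + bdry_u q r + bdry_p q r)
  - (q == iu)%:R *: bdry_b r + (r == iu)%:R *: bdry_b q.

Lemma bdry_homotopyE q r : - \sum_k lie (ep k) (e k q r)
    - (q == iu)%:R *: \sum_(i < n) e (ix i) (ip i) r
    + (r == iu)%:R *: \sum_(i < n) e (ix i) (ip i) q = bdry_homotopy q r.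
Proof.
rewrite /bdry_homotopy /bdry_b; congr (- _ - _ + _).
rewrite sum_slots slotE; congr (_ + _ + _).
  by apply: eq_bigr => i _; rewrite slotE.
by apply: eq_bigr => i _; rewrite slotE.
Qed.

Lemma bdry_x_xx k m : bdry_x (ix k) (ix m) = 0.
Proof. by apply: big1 => i _; rewrite homotopy_xxx lie0r. Qed.
Lemma bdry_u_xx k m : bdry_u (ix k) (ix m) =
  lie (E top bot) (lowmx (fun=> 0) (fun=> 0) (- c (ix k) (ix m) top top)).
Proof. by rewrite /bdry_u homotopy_rot homotopy_xxu. Qed.
Lemma bdry_p_xx k m : bdry_p (ix k) (ix m) = \sum_i lie (E (mid i) bot)
  (lowmx (Q k m i) (fun j => - c (ix k) (ix m) (mid i) (mid j)) 0).
Proof. by apply: eq_bigr => i _; rewrite homotopy_rot homotopy_xxp. Qed.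

Lemma bdry_x_pp k m : bdry_x (ip k) (ip m) = \sum_i lie (E top (mid i))
  (lowmx (fun j => c (ip k) (ip m) (mid j) (mid i)) (Q' i k m) 0).
Proof. by apply: eq_bigr => i _; rewrite homotopy_xpp. Qed.
Lemma bdry_u_pp k m : bdry_u (ip k) (ip m) =
  lie (E top bot) (lowmx (fun=> 0) (fun=> 0) (c (ip k) (ip m) bot bot)).
Proof. by rewrite /bdry_u homotopy_rot homotopy_ppu. Qed.
Lemma bdry_p_pp k m : bdry_p (ip k) (ip m) = 0.
Proof. by apply: big1 => i _; rewrite homotopy_ppp lie0r. Qed.

Lemma bdry_x_xp k l : bdry_x (ix k) (ip l) =
  block9 (\sum_i Q i k l i) (fun=> 0) 0 (fun=> 0) (fun i j => - Q j k l i) (fun=> 0)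
    0 (fun=> - 0) 0.
Proof.
apply: etrans (sum_lie_ix (fun i => Q i k l)
  (fun i j => - c (ix i) (ix k) (mid l) (mid j)) (fun=> 0)).
by apply: eq_bigr => i _; rewrite homotopy_xxp.
Qed.
Lemma bdry_u_xp k l : bdry_u (ix k) (ip l) =
  lie (E top bot) (lowmx (fun=> 0) (fun=> 0) (Z k l)).
Proof. by rewrite /bdry_u homotopy_rot homotopy_xpu. Qed.
Lemma bdry_p_xp k l : bdry_p (ix k) (ip l) = \sum_i lie (E (mid i) bot)
  (lowmx (fun j => - c (ip i) (ip l) (mid j) (mid k)) (fun j => - Q' k i l j) (- 0)).
Proof.
by apply: eq_bigr => i _; rewrite homotopyC12 homotopy_xpp lowmxN.
Qed.

Lemma bdry_x_ux m : bdry_x iu (ix m) =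
  block9 (\sum_(i < n) - 0) (fun=> 0) 0 (fun=> 0) (fun _ _ => - - 0) (fun=> 0)
    0 (fun i => - - - c (ix i) (ix m) top top) 0.
Proof.
apply: etrans (sum_lie_ix (fun _ _ => - 0) (fun _ _ => - 0)
  (fun i => - - c (ix i) (ix m) top top)).
by apply: eq_bigr => i _; rewrite homotopyC23 homotopy_xxu lowmxN.
Qed.
Lemma homotopy_uu q : e iu iu q = 0.
Proof. by apply: eq_oppr0; rewrite -homotopyC12. Qed.
Lemma bdry_u_u q : bdry_u iu q = 0.
Proof. by rewrite /bdry_u homotopy_uu lie0r. Qed.
Lemma bdry_p_ux m : bdry_p iu (ix m) = \sum_i lie (E (mid i) bot)
  (lowmx (fun=> 0) (fun=> 0) (Z m i)).
Proof. by apply: eq_bigr => i _; rewrite -homotopy_rot homotopy_xpu. Qed.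
Lemma bdry_b_x m : bdry_b (ix m) = \sum_i
  (lowmx (fun j => - Q i m i j) (fun j => - - c (ix i) (ix m) (mid i) (mid j)) (- 0)).
Proof. by apply: eq_bigr => i _; rewrite homotopyC23 homotopy_xxp lowmxN. Qed.

Lemma bdry_x_up m : bdry_x iu (ip m) =
  block9 (\sum_(i < n) - 0) (fun=> 0) 0 (fun=> 0) (fun _ _ => - - 0) (fun=> 0)
    0 (fun i => - - Z i m) 0.
Proof.
apply: etrans (sum_lie_ix (fun _ _ => - 0) (fun _ _ => - 0) (fun i => - Z i m)).
by apply: eq_bigr => i _; rewrite homotopyC23 homotopy_xpu lowmxN.
Qed.
Lemma bdry_p_up m : bdry_p iu (ip m) = \sum_i lie (E (mid i) bot)
  (lowmx (fun=> - 0) (fun=> - 0) (- c (ip i) (ip m) bot bot)).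
Proof. by apply: eq_bigr => i _; rewrite homotopyC23 homotopy_ppu lowmxN. Qed.
Lemma bdry_b_p m : bdry_b (ip m) = \sum_i
  (lowmx (fun j => c (ip i) (ip m) (mid j) (mid i)) (Q' i i m) 0).
Proof. by apply: eq_bigr => i _; rewrite homotopy_xpp. Qed.

Lemma sum_lowmx (x y : 'I_n -> 'I_n -> C) (z : 'I_n -> C) :
  \sum_i lowmx (x i) (y i) (z i) =
  lowmx (fun j => \sum_i x i j) (fun j => \sum_i y i j) (\sum_i z i).
Proof.
apply/matrixP => a b; rewrite summxE.
case: (blockP a) => [|j|]; case: (blockP b) => [|k|]; rewrite !block9E;
  under eq_bigr do rewrite !block9E; by [|rewrite big1].
Qed.

Lemma sum_Q_left k l :
  \sum_i Q i k l i = (\sum_m B k l m m - \sum_m B m l m k) / 2.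
Proof. by rewrite -sumrB mulr_suml; apply: eq_bigr => i _. Qed.
Lemma sum_Q_mid k l :
  \sum_i Q i k i l = (\sum_m B k m l m - \sum_m B m m l k) / 2.
Proof. by rewrite -sumrB mulr_suml; apply: eq_bigr => i _. Qed.
Lemma sum_Q'_right k l : \sum_i Q' k i l i =
  (\sum_m B k l m m + \sum_m B m l m k - \sum_m B k m l m - \sum_m B m m l k) / 4.
Proof.
rewrite -big_split -!sumrB mulr_suml; apply: eq_bigr => i _.
by rewrite /Q' /B1 /=; field.
Qed.
Lemma sum_Q'_left k l : \sum_i Q' i i l k =
  (\sum_m B k l m m + \sum_m B m l m k - \sum_m B k m l m - \sum_m B m m l k) / 4.
Proof.
rewrite -big_split -!sumrB mulr_suml; apply: eq_bigr => i _.
by rewrite /Q' /B1 /=; field.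
Qed.

(** Two slots of equal type carry no homology in homogeneity 2. Here and in [bdry_homotopy_pp],
    [primitive] copies the gl_n-block and one corner entry from [c]; the other corner entry follows
    from the vanishing trace. *)
Lemma bdry_homotopy_xx k m :
  hom_part 2 c (ix k) (ix m) = bdry_homotopy (ix k) (ix m).
Proof.
rewrite /bdry_homotopy !slot_eqE !scale0r subr0 addr0.
rewrite bdry_x_xx add0r bdry_u_xx lie_iu bdry_p_xx sum_lie_ip.
apply/matrixP => a b; rewrite homE.
case: (blockP a) => [|i|]; case: (blockP b) => [|j|]; rewrite !homE !block9E /= ?block_simp ?opprK //.
by rewrite sumrN opprK c_bot opprD.
Qed.

Lemma bdry_homotopy_pp k m :
  hom_part 2 c (ip k) (ip m) = bdry_homotopy (ip k) (ip m).
Proof.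
rewrite /bdry_homotopy !slot_eqE !scale0r subr0 addr0.
rewrite bdry_x_pp bdry_u_pp bdry_p_pp sum_lie_ix lie_iu addr0.
apply/matrixP => a b; rewrite homE.
case: (blockP a) => [|i|]; case: (blockP b) => [|j|]; rewrite !homE !block9E /= ?block_simp ?opprK //.
by rewrite c_top opprD addrC.
Qed.

(** In the gl_n-block, [Q] and [Q'] make up the difference between [B] and its symmetrization. [Z]
    is chosen to match the E_0^0 entry, after which the E_(n+1)^(n+1) entry agrees because of
    [sum_traces]. *)
Lemma bdry_homotopy_xp k l :
  hom_part 2 c (ix k) (ip l) - W_chain Wsym (ix k) (ip l) = bdry_homotopy (ix k) (ip l).
Proof.
rewrite /bdry_homotopy !slot_eqE !scale0r subr0 addr0 W_chain_xp Wsym_trace.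
rewrite bdry_x_xp bdry_u_xp bdry_p_xp lie_iu (sum_lie_ip _ (fun i j => - Q' k i l j)).
apply/matrixP => a b; rewrite [LHS]mxE homE.
case: (blockP a) => [|i|]; case: (blockP b) => [|j|]; rewrite !homE !block9E /= ?block_simp ?opprK //.
- have H (x y : C) : x = - (y + (- x - y)) by ring.
  exact: H.
- rewrite /Wsym /Q /Q' /B1 -/(B k l i j).
  move: (B _ _ _ _) (B _ _ _ _) (B _ _ _ _) (B _ _ _ _) => x1 x2 x3 x4.
  by field.
- rewrite sumrN opprB opprK /Z sum_Q_left sum_Q'_right c_bot.
  have := sum_traces l k; rewrite -/(B k l) => /eqP; rewrite addr_eq0 => /eqP.
  move: (\sum_m _) (\sum_m _) (\sum_m _) (\sum_m _) => p q r t.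
  by move/(congr1 -%R); rewrite opprK => <-; field.
Qed.

(** With a slot [iu] no coefficient of [primitive] is left to choose, here and in
    [bdry_homotopy_up]: the cycle condition expresses these components of [c] through those without
    [iu], for which [primitive] has already been adjusted. *)
Lemma bdry_homotopy_ux m :
  hom_part 2 c iu (ix m) = bdry_homotopy iu (ix m).
Proof.
rewrite /bdry_homotopy !slot_eqE !scale0r scale1r addr0.
rewrite bdry_x_ux bdry_u_u bdry_p_ux bdry_b_x.
rewrite (sum_lie_ip (fun _ _ => 0)) (sum_lowmx (fun i j => - Q i m i j)) addr0.
apply/matrixP => a b; rewrite homE.
case: (blockP a) => [|i|]; case: (blockP b) => [|j|]; rewrite !homE !block9E /= ?block_simp ?opprK //.
- by rewrite big1 ?oppr0.
- rewrite sumrN opprK /Z sum_Q_left sum_Q_mid closed_mid_bot ?slot_eqE //.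
  have -> : \sum_(j < n) c (ip j) (ix m) (mid i) (mid j) = - \sum_j B m j i j.
    by rewrite -sumrN; apply: eq_bigr => j _; rewrite (calt (ix m)) mxE.
  rewrite (calt (ix m) (ip i)) mxE c_bot -/(B m i).
  have := sum_traces i m => /eqP; rewrite addr_eq0 => /eqP.
  move: (\sum_(m0 < n) _) (\sum_(m0 < n) _) (\sum_(m0 < n) _) (\sum_(m0 < n) _) => p q r t.
  by move/(congr1 -%R); rewrite opprK => <-; field.
- by rewrite big1 ?oppr0.
- by rewrite closed_top_mid ?slot_eqE //; congr (_ - _); apply: eq_bigr => l _; rewrite opprK.
- by rewrite big1 ?oppr0.
Qed.

Lemma bdry_homotopy_up m :
  hom_part 2 c iu (ip m) = bdry_homotopy iu (ip m).
Proof.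
rewrite /bdry_homotopy !slot_eqE !scale0r scale1r addr0.
rewrite bdry_x_up bdry_u_u bdry_p_up bdry_b_p.
rewrite (sum_lie_ip (fun _ _ => - 0)) sum_lowmx addr0.
apply/matrixP => a b; rewrite homE.
case: (blockP a) => [|i|]; case: (blockP b) => [|j|]; rewrite !homE !block9E /= ?block_simp ?opprK //.
- by rewrite big1 ?oppr0.
- by rewrite closed_mid_bot ?slot_eqE.
- by rewrite big1 ?oppr0.
- rewrite closed_top_mid ?slot_eqE // /Z sum_Q_left sum_Q'_left.
  have -> : \sum_(i < n) c (ix i) (ip m) (mid i) (mid j) = \sum_i B i m i j by [].
  have := sum_traces m j => /eqP; rewrite addr_eq0 => /eqP.
  move: (\sum_(m0 < n) _) (\sum_(m0 < n) _) (\sum_(m0 < n) _) (\sum_(m0 < n) _) => p q r t.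
  by move/(congr1 -%R); rewrite opprK => <-; field.
- by rewrite big1 ?oppr0.
Qed.

Lemma alternating_eq (d d' : chain2 R n) :
  (forall q r, d r q = - d q r) -> (forall q r, d' r q = - d' q r) ->
  (forall k l, d (ix k) (ix l) = d' (ix k) (ix l)) ->
  (forall k l, d (ix k) (ip l) = d' (ix k) (ip l)) ->
  (forall k l, d (ip k) (ip l) = d' (ip k) (ip l)) ->
  (forall l, d iu (ix l) = d' iu (ix l)) ->
  (forall l, d iu (ip l) = d' iu (ip l)) ->
  forall q r, d q r = d' q r.
Proof.
move=> dC d'C dxx dxp dpp dux dup q r.
case: (slotP q) => [i||i]; case: (slotP r) => [j||j] //.
- by rewrite dC d'C dux.
- by rewrite (eq_oppr0 (dC iu iu)) (eq_oppr0 (d'C iu iu)).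
- by rewrite dC d'C dxp.
- by rewrite dC d'C dup.
Qed.

Lemma bdry_homotopyC q r : bdry_homotopy r q = - bdry_homotopy q r.
Proof.
have ec k : e k r q = - e k q r by exact: homotopyC23.
rewrite /bdry_homotopy.
have -> : bdry_x r q = - bdry_x q r.
  by rewrite -sumrN; apply: eq_bigr => i _; rewrite ec lieNr.
have -> : bdry_u r q = - bdry_u q r by rewrite /bdry_u ec lieNr.
have -> : bdry_p r q = - bdry_p q r.
  by rewrite -sumrN; apply: eq_bigr => i _; rewrite ec lieNr.
have H (x1 x2 x3 x4 x5 : M) :
    - (- x1 - x2 - x3) - x4 + x5 = - (- (x1 + x2 + x3) - x5 + x4).
  by apply/matrixP => a b; rewrite !mxE; ring.
exact: H.
Qed.

Lemma homogeneityC k l (a b : 'I_n.+2) : homogeneity l k a b = homogeneity k l a b.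
Proof. by rewrite /homogeneity [(wt l)%:Z + _]addrC. Qed.

Lemma hom_partC d k l : hom_part d c l k = - hom_part d c k l.
Proof.
apply/matrixP => a b; rewrite !mxE homogeneityC (calt k) mxE.
by case: ifP; rewrite ?oppr0.
Qed.

Lemma is_W_component_sym : is_W_component c Wsym.
Proof.
split; first exact: Wsym_symmetries.
apply: in_image_ext (bdry3_alternation in_g_primitive) => q r.
rewrite [LHS]bdry_homotopyE.
apply/esym; move: q r; apply: (alternating_eq (d := fun q r => _)).
- move=> q r; rewrite hom_partC W_chainC.
  have H (x y : M) : - x - - y = - (x - y) by apply/matrixP => a b; rewrite !mxE; ring.
  exact: H.
- exact: bdry_homotopyC.
- move=> k l; rewrite -bdry_homotopy_xx W_chain_eq0 ?subr0 // => k' l'; rewrite !slot_eqE ?andbF //.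
- exact: bdry_homotopy_xp.
- move=> k l; rewrite -bdry_homotopy_pp W_chain_eq0 ?subr0 // => k' l'; rewrite !slot_eqE ?andbF //.
- move=> l; rewrite -bdry_homotopy_ux W_chain_eq0 ?subr0 // => k' l'; rewrite !slot_eqE ?andbF //.
- move=> l; rewrite -bdry_homotopy_up W_chain_eq0 ?subr0 // => k' l'; rewrite !slot_eqE ?andbF //.
Qed.
End Exactness.
(** * Gauge transformations *)

Section Derivatives.
Local Open Scope classical_set_scope.
Local Open Scope ring_scope.
Variables (R : realType) (V : normedModType (Cx R)) (x v : V).
Local Notation C := (Cx R).
Implicit Types f g : V -> C.

Lemma is_derive_add f g (a b : C) : is_derive x v f a -> is_derive x v g b ->
  is_derive x v (fun y => f y + g y) (a + b).
Proof. exact: is_deriveD. Qed.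

Lemma is_derive_opp f (a : C) : is_derive x v f a ->
  is_derive x v (fun y => - f y) (- a).
Proof. exact: is_deriveN. Qed.

Lemma is_derive_mul f g (a b : C) : is_derive x v f a -> is_derive x v g b ->
  is_derive x v (fun y => f y * g y) (a * g x + f x * b).
Proof.
move=> fa gb; apply: is_derive_eq (is_deriveM fa gb) _.
by rewrite addrC mulrC.
Qed.

Lemma is_derive_const (a : C) : is_derive x v (fun _ => a) 0.
Proof. exact: is_derive_cst. Qed.

Lemma is_deriveE f (a : C) : is_derive x v f a -> 'D_v f x = a.
Proof. by case. Qed.

Lemma is_derive_derivable f (a : C) : is_derive x v f a -> derivable f x v.
Proof. by case. Qed.

Lemma is_derive_ext f g (a b : C) : (forall y, f y = g y) -> a = b ->
  is_derive x v f a -> is_derive x v g b.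
Proof. by move=> /funext -> ->. Qed.

Lemma is_derive_bigsum (J : Type) (r : seq J) (P : pred J) (F : J -> V -> C) (dF : J -> C) :
  (forall j, is_derive x v (F j) (dF j)) ->
  is_derive x v (fun y => \sum_(j <- r | P j) F j y) (\sum_(j <- r | P j) dF j).
Proof.
move=> H; elim: r => [|j r IH].
  apply: is_derive_ext (is_derive_const 0) => [y|]; by rewrite big_nil.
have [Pj|/negPf Pj] := boolP (P j); last first.
  by apply: is_derive_ext IH => [y|]; rewrite big_cons Pj.
by apply: is_derive_ext (is_derive_add (H j) IH) => [y|]; rewrite big_cons Pj.
Qed.

Lemma is_derive_bigprod (J : eqType) (r : seq J) (F : J -> V -> C) (dF : J -> C) :
  uniq r -> (forall j, is_derive x v (F j) (dF j)) ->
  is_derive x v (fun y => \prod_(j <- r) F j y)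
    (\sum_(j <- r) dF j * \prod_(i <- r | i != j) F i x).
Proof.
move=> + H; elim: r => [_|j r IH /= /andP[jr /IH{}IH]].
  apply: is_derive_ext (is_derive_const 1) => [y|]; by rewrite big_nil.
apply: is_derive_ext (is_derive_mul (H j) IH) => [y|]; first by rewrite big_cons.
rewrite [RHS]big_cons; congr (_ + _).
  congr (_ * _); rewrite big_cons eqxx /= [RHS]big_seq_cond big_seq.
  apply: eq_bigl => i; case: (boolP (i \in r)) => //= ir.
  by rewrite (memPn jr).
rewrite mulr_sumr [LHS]big_seq [RHS]big_seq; apply: eq_bigr => i ir.
by rewrite big_cons eq_sym (memPn jr) // mulrCA.
Qed.

(** Jacobi's formula. The product rule in the Leibniz expansion yields the determinants in which one
    row is replaced by its derivative, and expanding along that row produces the adjugate. *)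
Lemma is_derive_det (m : nat) (F : V -> 'M[C]_m) (dF : 'M[C]_m) :
  (forall i j, is_derive x v (fun y => F y i j) (dF i j)) ->
  is_derive x v (fun y => \det (F y)) (\tr (\adj (F x) *m dF)).
Proof.
move=> H.
have dprod (s : 'S_m) : is_derive x v (fun y => (-1) ^+ s * \prod_(i < m) F y i (s i))
   (0 * \prod_(i < m) F x i (s i) +
    (-1) ^+ s * \sum_(i < m) dF i (s i) * \prod_(j < m | j != i) F x j (s j)).
  apply: (is_derive_mul (is_derive_const ((-1) ^+ s))).
  by apply: (@is_derive_bigprod _ _ (fun i y => F y i (s i))); rewrite ?index_enum_uniq.
apply: is_derive_ext (is_derive_bigsum _ _ dprod) => [y|]; first by [].
under eq_bigr do rewrite mul0r add0r mulr_sumr.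
rewrite exchange_big /mxtrace.
under [RHS]eq_bigr do rewrite mxE.
rewrite [RHS]exchange_big; apply: eq_bigr => i _.
pose Fi : 'M[C]_m := \matrix_(a, b) (if a == i then dF a b else F x a b).
transitivity (\det Fi).
  apply: eq_bigr => s _; rewrite [in RHS](bigD1 i) //= mxE eqxx; congr (_ * (_ * _)).
  by apply: eq_bigr => j /negPf ji; rewrite mxE ji.
rewrite (expand_det_row _ i); apply: eq_bigr => j _.
rewrite mxE eqxx mulrC mxE /cofactor; congr (_ * \det _ * _).
by apply/matrixP => a b; rewrite !mxE eq_sym (negPf (neq_lift _ _)).
Qed.

Definition mx_derivable (p q : nat) (F : V -> 'M[C]_(p, q)) : Prop :=
  forall i j, derivable (fun y => F y i j : C) x v.

(** This replaces the derivability of the inverse matrix: for determinant 1 the adjugate is the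
    inverse, and its entries are polynomials. *)
Lemma mx_derivable_adj (m : nat) (F : V -> 'M[C]_m) :
  mx_derivable F -> mx_derivable (fun y => \adj (F y)).
Proof.
move=> dF i j.
have H a b : is_derive x v (fun y => F y a b) ('D_v (fun y => F y a b) x).
  by apply/derivableP/dF.
pose G y := row' j (col' i (F y)).
have dG a b : is_derive x v (fun y => G y a b)
    ((\matrix_(a, b) 'D_v (fun y => G y a b : C) x) a b).
  rewrite mxE; apply/derivableP; rewrite /G.
  have -> : (fun y => row' j (col' i (F y)) a b) = (fun y => F y (lift j a) (lift i b)).
    by apply/funext => y; rewrite !mxE.
  exact: dF.
have -> : (fun y => (\adj (F y)) i j : C) = (fun y => (-1) ^+ (j + i) * \det (G y)).
  by apply/funext => y; rewrite /adjugate mxE.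
exact: is_derive_derivable (is_derive_mul (is_derive_const ((-1) ^+ (j + i))) (is_derive_det dG)).
Qed.
End Derivatives.

(** * Connection and curvature along a section *)

Section Gauge.
Local Open Scope classical_set_scope.
Local Open Scope ring_scope.
Variables (R : realType) (n : nat).
Local Notation C := (Cx R).
Local Notation pt := (ptM R n).
Local Notation M := (mat R n).
Implicit Types F G : pt -> M.
Local Opaque mid top bot.

Lemma block_upperP (X : M) : (forall i, X (mid i) top = 0) -> X bot top = 0 ->
  (forall i, X bot (mid i) = 0) -> block_upper X.
Proof.
move=> X1 X2 X3 a b; case: (blockP a) => [|i|]; case: (blockP b) => [|j|];
  by rewrite ?blk_top ?blk_mid ?blk_bot.
Qed.

Lemma block_upper_mid_top (X : M) i : block_upper X -> X (mid i) top = 0.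
Proof. by apply; rewrite blk_top blk_mid. Qed.
Lemma block_upper_bot_top (X : M) : block_upper X -> X bot top = 0.
Proof. by apply; rewrite blk_top blk_bot. Qed.
Lemma block_upper_bot_mid (X : M) i : block_upper X -> X bot (mid i) = 0.
Proof. by apply; rewrite blk_mid blk_bot. Qed.

Lemma mulmx_bot (X Y : M) b : block_upper X -> (X *m Y) bot b = X bot bot * Y bot b.
Proof.
move=> Xu; rewrite mxE sum_blocks block_upper_bot_top // mul0r add0r.
by rewrite big1 ?add0r // => i _; rewrite block_upper_bot_mid // mul0r.
Qed.

Lemma mulmx_top (X Y : M) a : block_upper Y -> (X *m Y) a top = X a top * Y top top.
Proof.
move=> Yu; rewrite mxE sum_blocks block_upper_bot_top // mulr0 addr0.
by rewrite big1 ?addr0 // => i _; rewrite block_upper_mid_top // mulr0.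
Qed.

Lemma block_upper_mul (X Y : M) : block_upper X -> block_upper Y -> block_upper (X *m Y).
Proof.
move=> Xu Yu; apply: block_upperP => [i||i].
- by rewrite mulmx_top // block_upper_mid_top // mul0r.
- by rewrite mulmx_top // block_upper_bot_top // mul0r.
- by rewrite mulmx_bot // block_upper_bot_mid // mulr0.
Qed.

Lemma in_P_unit (h : M) : in_P h -> h \in unitmx.
Proof. by case=> h1 _; rewrite unitmxE h1 unitr1. Qed.

(** The last row of [h *m invmx h] and the first column of [invmx h *m h] each involve a single
    corner entry of [h]. That entry is therefore nonzero and can be cancelled. *)
Lemma block_upper_inv (h : M) : in_P h -> block_upper (invmx h).
Proof.
move=> hP; have hu := in_P_unit hP; case: hP => _ hb.
have hl a b : (h *m invmx h) a b = (a == b)%:R by rewrite mulmxV // mxE.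
have hr a b : (invmx h *m h) a b = (a == b)%:R by rewrite mulVmx // mxE.
have hbb : h bot bot != 0.
  apply/eqP => h0; have := hl bot bot; rewrite mulmx_bot // h0 mul0r eqxx => /eqP.
  by rewrite eq_sym oner_eq0.
have htt : h top top != 0.
  apply/eqP => h0; have := hr top top; rewrite mulmx_top // h0 mulr0 eqxx => /eqP.
  by rewrite eq_sym oner_eq0.
have bz b : bot != b -> invmx h bot b = 0.
  move=> /negPf ab; have := hl bot b; rewrite mulmx_bot // ab => /eqP.
  by rewrite mulf_eq0 (negPf hbb) => /eqP.
have tz a : a != top -> invmx h a top = 0.
  move=> /negPf ab; have := hr a top; rewrite mulmx_top // ab => /eqP.
  by rewrite mulf_eq0 (negPf htt) orbF => /eqP.
by apply: block_upperP => [i||i]; [apply: tz|apply: tz|apply: bz]; rewrite !block_eqE.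
Qed.

Lemma in_P1 : in_P (1%:M : M).
Proof.
split; first exact: det1.
by apply: block_upperP => [i||i]; rewrite mxE !block_eqE.
Qed.

Lemma mx_derivE F v x a b : mx_deriv F v x a b = 'D_v (fun y => F y a b : C) x.
Proof. by rewrite mxE. Qed.

Local Opaque mx_deriv.

Lemma is_derive_mx F v x a b : mx_derivable x v F ->
  is_derive x v (fun y => F y a b) (mx_deriv F v x a b).
Proof. by move=> dF; rewrite mx_derivE; apply/derivableP/dF. Qed.

Lemma is_derive_mulmx F G v x a b : mx_derivable x v F -> mx_derivable x v G ->
  is_derive x v (fun y => (F y *m G y) a b)
    ((mx_deriv F v x *m G x + F x *m mx_deriv G v x) a b).
Proof.
move=> dF dG.
have H c := is_derive_mul (is_derive_mx a c dF) (is_derive_mx c b dG).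
apply: is_derive_ext (is_derive_bigsum _ _ H) => [y|]; first by rewrite mxE.
by rewrite [RHS]mxE 2!mxE -big_split.
Qed.

Lemma mx_deriv_mul F G v x :
  mx_derivable x v F -> mx_derivable x v G ->
  mx_deriv (fun y => F y *m G y) v x = mx_deriv F v x *m G x + F x *m mx_deriv G v x.
Proof.
move=> dF dG; apply/matrixP => a b; rewrite mx_derivE.
exact: is_deriveE (is_derive_mulmx a b dF dG).
Qed.

Lemma mx_derivable_mul F G v x :
  mx_derivable x v F -> mx_derivable x v G -> mx_derivable x v (fun y => F y *m G y).
Proof. by move=> dF dG a b; apply: is_derive_derivable (is_derive_mulmx a b dF dG). Qed.

Lemma is_derive_addmx F G v x a b : mx_derivable x v F -> mx_derivable x v G ->
  is_derive x v (fun y => (F y + G y) a b) ((mx_deriv F v x + mx_deriv G v x) a b).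
Proof.
move=> dF dG.
apply: is_derive_ext (is_derive_add (is_derive_mx a b dF) (is_derive_mx a b dG)) => [y|];
  by rewrite [RHS]mxE.
Qed.

Lemma mx_derivable_add F G v x :
  mx_derivable x v F -> mx_derivable x v G -> mx_derivable x v (fun y => F y + G y).
Proof. by move=> dF dG a b; apply: is_derive_derivable (is_derive_addmx a b dF dG). Qed.

Lemma mx_deriv_add F G v x :
  mx_derivable x v F -> mx_derivable x v G ->
  mx_deriv (fun y => F y + G y) v x = mx_deriv F v x + mx_deriv G v x.
Proof.
move=> dF dG; apply/matrixP => a b; rewrite mx_derivE.
exact: is_deriveE (is_derive_addmx a b dF dG).
Qed.

Variables (U : set pt) (hU : open U).

Lemma near_in (x : pt) : U x -> \forall y \near x, U y.
Proof. by move=> Ux; apply: open_nbhs_nbhs. Qed.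

Lemma derive_eq_on (f g : pt -> C) v x : U x -> (forall y, U y -> f y = g y) ->
  'D_v f x = 'D_v g x.
Proof.
by move=> Ux fg; apply: near_eq_derive; apply: filterS (near_in Ux) => y /fg.
Qed.

Lemma derive_eq_const (f : pt -> C) (a : C) v x : U x -> (forall y, U y -> f y = a) ->
  'D_v f x = 0.
Proof.
move=> Ux fa; apply: etrans (derive_eq_on v Ux fa) _.
exact: (is_deriveE (is_derive_const x v a)).
Qed.

Lemma mx_deriv_eq_on F G v x : U x -> (forall y, U y -> F y = G y) ->
  mx_deriv F v x = mx_deriv G v x.
Proof.
move=> Ux FG.
apply/matrixP => a b.
apply: etrans (mx_derivE F v x a b) (etrans _ (esym (mx_derivE G v x a b))).
apply: near_eq_derive.
by apply: filterS (near_in Ux) => y /FG ->.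
Qed.

Lemma mx_derivable_eq_on F G v x : U x -> (forall y, U y -> F y = G y) ->
  mx_derivable x v F -> mx_derivable x v G.
Proof.
move=> Ux FG dF a b; apply: near_eq_derivable (dF a b).
by apply: filterS (near_in Ux) => y /FG ->.
Qed.

Variables (omega : form1 R n) (hcartan : cartan_connection U omega).
Variables (s : pt -> M) (hs : is_section U s).

Lemma section_in_P y : U y -> in_P (s y).
Proof. by case: hs => + _; apply. Qed.

Lemma section_mx_derivable x v : U x -> mx_derivable x v s.
Proof.
move=> Ux a b; apply: diff_derivable; case: hs => _ /(_ a b) /(_ [::] x Ux).
exact.
Qed.

(** Linearity splits off the vertical part and equivariance moves [h] to the identity, so everything
    is expressed through the single matrix-valued form [omega y 1%:M v 0] on [U]. *)
Lemma omega_gauge y h v X : U y -> in_P h -> in_p X ->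
  omega y h v X = invmx h *m omega y 1%:M v 0 *m h + X.
Proof.
move=> Uy hP Xp.
have p0 : in_p (0 : M).
  by split; [rewrite /in_g mxtrace0|move=> a b _; rewrite mxE].
have := cc_linear hcartan 1 v 0 Uy hP p0 Xp.
rewrite !scale1r addr0 add0r (cc_fundamental hcartan Uy hP Xp) => ->; congr (_ + _).
have := cc_equivariant hcartan v Uy in_P1 hP p0.
by rewrite mul1mx mulmx0 mul0mx.
Qed.

(** The trace is the derivative of [\det (s y) = 1], by Jacobi's formula. The axioms of
    [cartan_connection] concern vertical parts in p only, and this is what makes them applicable to
    [pullback]. *)
Lemma maurer_cartan_in_p x v : U x -> in_p (invmx (s x) *m mx_deriv s v x).
Proof.
move=> Ux; have sP := section_in_P Ux; split.
  have ds i j : is_derive x v (fun y => s y i j) (mx_deriv s v x i j).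
    by rewrite mx_derivE; apply/derivableP/section_mx_derivable.
  have := is_deriveE (is_derive_det ds).
  rewrite (_ : invmx (s x) = \adj (s x)).
    rewrite /in_g => <-; apply: (derive_eq_const (a := 1)) => // y.
    by case/section_in_P.
  by rewrite /invmx in_P_unit //; case: sP => -> _; rewrite invr1 scale1r.
apply: block_upper_mul; first exact: block_upper_inv.
move=> a b ab; rewrite mx_derivE; apply: (derive_eq_const (a := 0)) => // y.
by case/section_in_P => _; apply.
Qed.

Local Notation A := (pullback omega s).

Lemma pullbackE y v : U y ->
  A y v = invmx (s y) *m omega y 1%:M v 0 *m s y + invmx (s y) *m mx_deriv s v y.
Proof.
move=> Uy; rewrite /pullback omega_gauge //; first exact: section_in_P.
exact: maurer_cartan_in_p.
Qed.

Lemma mulmx_pullback y v : U y ->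
  s y *m A y v = omega y 1%:M v 0 *m s y + mx_deriv s v y.
Proof.
move=> Uy; have su := in_P_unit (section_in_P Uy).
by rewrite pullbackE // mulmxDr -!mulmxA !mulKVmx.
Qed.

Lemma omega_mx_derivable x v w : U x -> mx_derivable x v (fun y => omega y 1%:M w 0).
Proof.
move=> Ux a b; apply: diff_derivable.
have p0 : in_p (0 : M).
  by split; [rewrite /in_g mxtrace0|move=> ? ? _; rewrite mxE].
exact: (cc_holomorphic hcartan w in_P1 p0 a b [::] Ux).
Qed.

Lemma section_deriv_mx_derivable x v w : U x -> mx_derivable x v (fun y => mx_deriv s w y).
Proof.
move=> Ux a b; apply: diff_derivable; case: hs => _ /(_ a b) /(_ [:: w] x Ux) /=.
by congr (differentiable _ _); apply/funext => y; rewrite mx_derivE.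
Qed.

Lemma pullback_mx_derivable x v w : U x -> mx_derivable x v (fun y => A y w).
Proof.
move=> Ux.
apply: (@mx_derivable_eq_on (fun y => \adj (s y) *m
  (omega y 1%:M w 0 *m s y + mx_deriv s w y))) => // [y Uy|].
  rewrite -mulmx_pullback // mulmxA mul_adj_mx; case: (section_in_P Uy) => -> _.
  by rewrite mul1mx.
have ds := @section_mx_derivable x v Ux.
apply: mx_derivable_mul; first exact: mx_derivable_adj.
apply: mx_derivable_add; last exact: section_deriv_mx_derivable.
exact: mx_derivable_mul (@omega_mx_derivable x v w Ux) ds.
Qed.

Lemma section_derive_comm x v w : U x ->
  mx_deriv (fun y => mx_deriv s w y) v x = mx_deriv (fun y => mx_deriv s v y) w x.
Proof.
move=> Ux; apply/matrixP => a b; set g : pt -> C := fun y => s y a b.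
have E u1 u2 : mx_deriv (fun y => mx_deriv s u1 y) u2 x a b = 'D_u2 ('D_u1 g) x.
  apply: etrans (mx_derivE _ _ _ _ _) _.
  by apply: derive_eq_on => // y _; exact: mx_derivE.
apply: etrans (E w v) (etrans _ (esym (E v w))).
case: hs => _ /(_ a b) ha; apply: derive_comm.
- by apply: filterS (near_in Ux) => y Uy; apply: (ha [::] y Uy).
- exact: (ha [:: w] x Ux).
- exact: (ha [:: v] x Ux).
Qed.

(** The matrix identity behind the conjugation law of the curvature. Multiplication by [S] on the
    left brings in the relations [S A = O S + D] and their derivatives; the second derivative [DD]
    of the section is common to both orders of differentiation and cancels. *)
Lemma gauge_algebra (S Si Ov Ow Dv Dw Av Aw dOw dOv dAw dAv DD : M) :
  S *m Si = 1%:M -> Si *m S = 1%:M ->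
  S *m Av = Ov *m S + Dv -> S *m Aw = Ow *m S + Dw ->
  Dv *m Aw + S *m dAw = dOw *m S + Ow *m Dv + DD ->
  Dw *m Av + S *m dAv = dOv *m S + Ov *m Dw + DD ->
  Si *m dOw *m S - Si *m dOv *m S + lie (Si *m Ov *m S) (Si *m Ow *m S) =
  dAw - dAv + lie Av Aw.
Proof.
move=> SSi SiS HAv HAw HdAw HdAv.
have SK (X : M) : S *m (Si *m X) = X by rewrite mulmxA SSi mul1mx.
have SiK (X : M) : Si *m (S *m X) = X by rewrite mulmxA SiS mul1mx.
rewrite -[LHS]SiK -[RHS]SiK; congr (_ *m _).
have L : S *m (Si *m dOw *m S - Si *m dOv *m S + lie (Si *m Ov *m S) (Si *m Ow *m S)) =
    dOw *m S - dOv *m S + (Ov *m Ow *m S - Ow *m Ov *m S).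
  by rewrite /lie mulmxDr !mulmxBr -!mulmxA !SK.
have SAA (B B' D D' : M) : S *m B = B' *m S + D -> S *m B *m D' = B' *m (S *m D') + D *m D'.
  by move=> ->; rewrite mulmxDl mulmxA.
have Q : S *m (dAw - dAv + lie Av Aw) =
    S *m dAw - S *m dAv + (S *m Av *m Aw - S *m Aw *m Av).
  by rewrite /lie mulmxDr !mulmxBr !mulmxA.
rewrite {}L {}Q (SAA _ _ _ Aw HAv) (SAA _ _ _ Av HAw) HAv HAw.
have -> : S *m dAw = dOw *m S + Ow *m Dv + DD - Dv *m Aw by rewrite -HdAw addrC addKr.
have -> : S *m dAv = dOv *m S + Ov *m Dw + DD - Dw *m Av by rewrite -HdAv addrC addKr.
rewrite (mulmxDr Ov) (mulmxDr Ow) !(mulmxA _ _ S).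
have H (x1 x2 x3 x4 x5 x6 x7 x8 x9 : M) :
  x1 - x2 + (x3 - x4) =
  x1 + x5 + x6 - x7 - (x2 + x8 + x6 - x9) + (x3 + x8 + x7 - (x4 + x5 + x9)).
  by apply/matrixP => i j; rewrite !mxE; ring.
exact: H.
Qed.

(* Differentiating s A = omega s + ds avoids the derivative of s^-1. *)
Lemma curvature_gauge x v w : U x -> curvature omega x (s x) v w =
  mx_deriv (fun y => A y w) v x - mx_deriv (fun y => A y v) w x + lie (A x v) (A x w).
Proof.
move=> Ux; have sP := section_in_P Ux; have su := in_P_unit sP.
set O := fun v y => omega y 1%:M v 0.
have p0 : in_p (0 : M).
  by split; [rewrite /in_g mxtrace0|move=> ? ? _; rewrite mxE].
have cstd (X : M) u : mx_derivable x u (fun _ => X) by move=> a b; apply: derivable_cst.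
have cst0 (X : M) u : mx_deriv (fun _ => X) u x = 0.
  by apply/matrixP => a b; rewrite mx_derivE derive_cst mxE.
(* [curvature] differentiates with the group component frozen at [s x], so that [omega] is
   conjugated by constant matrices here. *)
have dO u1 u2 : mx_deriv (fun y => omega y (s x) u1 0) u2 x =
    invmx (s x) *m mx_deriv (O u1) u2 x *m s x.
  rewrite (@mx_deriv_eq_on _ (fun y => invmx (s x) *m O u1 y *m s x)) //; last first.
    by move=> y Uy; rewrite omega_gauge // addr0.
  have d1 := @omega_mx_derivable x u2 u1 Ux.
  apply: etrans (mx_deriv_mul (mx_derivable_mul (cstd _ _) d1) (cstd _ _)) _.
  rewrite cst0 mulmx0 addr0; congr (_ *m _).
  apply: etrans (mx_deriv_mul (cstd _ _) d1) _.
  by rewrite cst0 mul0mx add0r.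
have dA u1 u2 : mx_deriv s u2 x *m A x u1 + s x *m mx_deriv (fun y => A y u1) u2 x =
    mx_deriv (O u1) u2 x *m s x + O u1 x *m mx_deriv s u2 x
    + mx_deriv (fun y => mx_deriv s u1 y) u2 x.
  have d1 := @omega_mx_derivable x u2 u1 Ux; have d2 := @section_mx_derivable x u2 Ux.
  have d3 := @section_deriv_mx_derivable x u2 u1 Ux.
  apply: etrans (esym (mx_deriv_mul d2 (@pullback_mx_derivable x u2 u1 Ux))) _.
  apply: etrans (mx_deriv_eq_on u2 Ux (fun y => @mulmx_pullback y u1)) _.
  apply: etrans (mx_deriv_add (mx_derivable_mul d1 d2) d3) _.
  exact: (congr1 (fun X : M => X + mx_deriv (fun y => mx_deriv s u1 y) u2 x) (mx_deriv_mul d1 d2)).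
have OE u : omega x (s x) u 0 = invmx (s x) *m O u x *m s x.
  by apply: etrans (omega_gauge u Ux sP p0) (addr0 _).
rewrite /curvature (dO w v) (dO v w) (OE v) (OE w).
apply: (@gauge_algebra _ _ _ _ (mx_deriv s v x) (mx_deriv s w x) _ _ _ _ _ _
  (mx_deriv (fun y => mx_deriv s w y) v x)).
- exact: mulmxV.
- exact: mulVmx.
- exact: mulmx_pullback.
- exact: mulmx_pullback.
- exact: dA.
- by rewrite section_derive_comm //; exact: dA.
Qed.
End Gauge.
(** * Structure equations *)

Section StructureEquations.
Local Open Scope classical_set_scope.
Local Open Scope ring_scope.
Variables (R : realType) (n : nat).
Local Notation C := (Cx R).
Local Notation pt := (ptM R n).
Local Notation M := (mat R n).
Local Notation dd := (@dd R n).
Local Opaque mid top bot ix iu ip mx_deriv.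

(* The components [u = w] and [z] of the homogeneity 1 curvature satisfy these
   equations in either of the bidegrees that carry no homology: the second
   hypothesis is normality and the third says that the curvature is exact. *)
Lemma torsion_solve (u w : 'I_n -> 'I_n -> 'I_n -> C) (z : 'I_n -> C) :
  (forall i l k, u i l k = w i l k) -> (forall l, z l + \sum_i w i l i = 0) ->
  (forall i l k, w i l k = (i == k)%:R * z l - (l == k)%:R * z i - u i l k + u l i k) ->
  (forall i l k, u i l k = 0) /\ (forall l, z l = 0).
Proof.
move=> uw zw wE.
have anti i l k : u l i k = - u i l k.
  by rewrite [LHS]uw [u i l k]uw !wE; ring.
(* By antisymmetry the last two terms of [wE] amount to [- 2 * u], so [3 * u] consists of delta
   terms; contracting them will give [(n + 2) * z = 0]. *)
have u3 i l k : 3 * u i l k = (i == k)%:R * z l - (l == k)%:R * z i.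
  have := wE i l k; rewrite -uw (anti i l k) => E.
  have -> : 3 * u i l k = u i l k + 2 * u i l k by ring.
  by rewrite {1}E; ring.
have z0 l : z l = 0.
  have H : 3 * \sum_i w i l i = n%:R * z l - z l.
    have -> : n%:R * z l = \sum_(i < n) z l by rewrite sumr_const card_ord mulr_natl.
    rewrite mulr_sumr -[X in _ - X](sum_kron_mul z l) -sumrB.
    by apply: eq_bigr => i _; rewrite -uw u3 eqxx mul1r.
  have zE : z l = - \sum_i w i l i by apply/eqP; rewrite -addr_eq0 zw.
  have : (n + 2)%:R * z l = 0.
    have : 3 * z l = - (n%:R * z l - z l) by rewrite -H [in LHS]zE mulrN.
    rewrite natrD => E; transitivity (3 * z l + (n%:R * z l - z l)); first by ring.
    by rewrite E addNr.
  by move/eqP; rewrite mulf_eq0 pnatr_eq0 addn2 /= => /eqP.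
split=> // i l k; apply/eqP.
have /eqP := u3 i l k; rewrite !z0 !mulr0 subr0 mulf_eq0 pnatr_eq0 /=.
by [].
Qed.

(** [B], [a] and [d] are the diagonal blocks of the connection form on d/dp_l. Once the torsion
    vanishes, [z = 0] gives [d = a], [u = 0] makes [B] the identity times [a], and the trace
    condition becomes [(n + 2) * a = 0]. *)
Lemma vertical_solve (B u w : 'I_n -> 'I_n -> 'I_n -> C) (a d z : 'I_n -> C) :
  (forall i l k, u i l k = (i == k)%:R * a l - B l i k) ->
  (forall k l i, w k l i = B l k i + d k * (i == l)%:R - (B k l i + d l * (i == k)%:R)) ->
  (forall l, z l = a l - d l) ->
  (forall i l k, u i l k = w i l k) -> (forall l, z l + \sum_i w i l i = 0) ->
  (forall l, a l + \sum_i B l i i + d l = 0) ->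
  forall l, (a l = 0) /\ (d l = 0) /\ (forall i j, B l i j = 0).
Proof.
move=> uE wE zE uw zw tr.
have [|u0 z0] := torsion_solve uw zw.
  by move=> i l k; rewrite wE !uE !zE [k == l]eq_sym [k == i]eq_sym; ring.
move=> l; have ad : d l = a l by apply/esym/eqP; rewrite -subr_eq0 -zE z0.
have BE i j : B l i j = (i == j)%:R * a l.
  by apply/esym/eqP; rewrite -subr_eq0 -uE u0.
have a0 : a l = 0.
  have := tr l; under eq_bigr do rewrite BE eqxx mul1r.
  rewrite ad sumr_const card_ord -[a l *+ n]mulr_natl.
  have -> : a l + n%:R * a l + a l = (n + 2)%:R * a l by rewrite natrD; ring.
  by move/eqP; rewrite mulf_eq0 pnatr_eq0 addn2 => /eqP.
by rewrite ad a0; split=> //; split=> // i j; rewrite BE a0 mulr0.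
Qed.

(** Here [g l i k] stands for the derivative of f_ik along d/dp_l. When [B], expressed through [v],
    is put into the equation for [y], the symmetric [g] drops out and a system of the form of
    [torsion_solve] remains. The entry [d] is left free; it only shifts [B] by a multiple of the
    identity. *)
Lemma horizontal_solve (B g v y : 'I_n -> 'I_n -> 'I_n -> C) (a d z : 'I_n -> C) :
  (forall l i k, g l i k = g l k i) ->
  (forall i k m, y i k m = (i == k)%:R * a m + B k i m - ((i == m)%:R * a k + B m i k)) ->
  (forall k l i, v k l i = g l i k + (d k * (i == l)%:R - B k l i)) ->
  (forall k, z k = a k - d k) ->
  (forall i k m, y i k m = - v m i k) -> (forall m, z m + \sum_i - v m i i = 0) ->
  forall k l i, B k l i = g l i k + (l == i)%:R * d k.
Proof.
move=> gs yE vE zE yv zv k l i.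
have [|u0 z0] := @torsion_solve (fun k m i => y i k m) (fun k m i => - v m i k) z
  (fun k m i => yv i k m) zv.
  move=> p q r; rewrite -(yv r p q) (yv r q p).
  have Bp : B p r q = g r q p + d p * (q == r)%:R - v p r q by rewrite vE; ring.
  have Bq : B q r p = g r q p + d q * (p == r)%:R + y r p q.
    by rewrite yv vE (gs r p q); ring.
  by rewrite {1}yE Bp Bq !zE [p == r]eq_sym [q == r]eq_sym; ring.
have := vE k l i; rewrite -[v k l i]opprK -yv u0 oppr0 [i == l]eq_sym => /eqP.
rewrite eq_sym addrA subr_eq0 => /eqP <-; ring.
Qed.

Lemma opp_entry (X : M) a b : (- X) a b = - X a b.
Proof. by rewrite mxE. Qed.

Lemma lie_entry (X Y : M) a b : lie X Y a b =
  X a top * Y top b + \sum_i X a (mid i) * Y (mid i) b + X a bot * Y bot b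
  - (Y a top * X top b + \sum_i Y a (mid i) * X (mid i) b + Y a bot * X bot b).
Proof. by rewrite /lie !mxE !sum_blocks. Qed.

(* The values of the connection form on the frame dual to theta, pi and sigma. *)
Definition horizontal (k : 'I_n) (X : M) : Prop :=
  [/\ forall m, X (mid m) top = (m == k)%:R, X bot top = 0 & forall m, X bot (mid m) = 0].
Definition vertical (k : 'I_n) (X : M) : Prop :=
  [/\ forall m, X (mid m) top = 0, X bot top = 0 & forall m, X bot (mid m) = (m == k)%:R].
Definition transversal (X : M) : Prop :=
  [/\ forall m, X (mid m) top = 0, X bot top = 1 & forall m, X bot (mid m) = 0].

Section LieEntries.
Variables (X Y : M) (tx ty px py : 'I_n -> C) (sx sy : C).
Hypotheses (Xt : forall m, X (mid m) top = tx m) (Yt : forall m, Y (mid m) top = ty m).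
Hypotheses (Xp : forall m, X bot (mid m) = px m) (Yp : forall m, Y bot (mid m) = py m).
Hypotheses (Xs : X bot top = sx) (Ys : Y bot top = sy).

Lemma lie_mid_top i : lie X Y (mid i) top =
  tx i * Y top top + \sum_m X (mid i) (mid m) * ty m + X (mid i) bot * sy
  - (ty i * X top top + \sum_m Y (mid i) (mid m) * tx m + Y (mid i) bot * sx).
Proof.
rewrite lie_entry Xt Yt Xs Ys; congr (_ + _ + _ - (_ + _ + _));
  by apply: eq_bigr => m _; rewrite ?Xt ?Yt.
Qed.

Lemma lie_bot_top : lie X Y bot top =
  sx * Y top top + \sum_m px m * ty m + X bot bot * sy
  - (sy * X top top + \sum_m py m * tx m + Y bot bot * sx).
Proof.
rewrite lie_entry Xs Ys; congr (_ + _ + _ - (_ + _ + _));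
  by apply: eq_bigr => m _; rewrite ?Xt ?Yt ?Xp ?Yp.
Qed.

Lemma lie_bot_mid i : lie X Y bot (mid i) =
  sx * Y top (mid i) + \sum_m px m * Y (mid m) (mid i) + X bot bot * py i
  - (sy * X top (mid i) + \sum_m py m * X (mid m) (mid i) + Y bot bot * px i).
Proof.
rewrite lie_entry Xs Ys Xp Yp; congr (_ + _ + _ - (_ + _ + _));
  by apply: eq_bigr => m _; rewrite ?Xp ?Yp.
Qed.
End LieEntries.

Lemma sum_mul0 (x : 'I_n -> C) : \sum_m x m * 0 = 0.
Proof. by rewrite big1 // => m _; rewrite mulr0. Qed.
Lemma sum_0mul (x : 'I_n -> C) : \sum_m 0 * x m = 0.
Proof. by rewrite big1 // => m _; rewrite mul0r. Qed.

Lemma lie_hv_mid_top (X Y : M) k l i : horizontal k X -> vertical l Y ->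
  lie X Y (mid i) top = (i == k)%:R * Y top top - Y (mid i) (mid k).
Proof.
case=> Xt Xs _ [Yt Ys _]; rewrite (lie_mid_top Xt Yt Xs Ys) sum_mul0.
by rewrite (sum_mul_kron (fun m => Y (mid i) (mid m))) !mulr0 mul0r !addr0 add0r.
Qed.

Lemma lie_hh_mid_top (X Y : M) k l i : horizontal k X -> horizontal l Y ->
  lie X Y (mid i) top = (i == k)%:R * Y top top + X (mid i) (mid l)
    - ((i == l)%:R * X top top + Y (mid i) (mid k)).
Proof.
case=> Xt Xs _ [Yt Ys _]; rewrite (lie_mid_top Xt Yt Xs Ys).
rewrite (sum_mul_kron (fun m => Y (mid i) (mid m))).
by rewrite (sum_mul_kron (fun m => X (mid i) (mid m))) !mulr0 !addr0.
Qed.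

Lemma lie_vv_bot_mid (X Y : M) k l i : vertical k X -> vertical l Y ->
  lie X Y bot (mid i) = Y (mid k) (mid i) + X bot bot * (i == l)%:R
    - (X (mid l) (mid i) + Y bot bot * (i == k)%:R).
Proof.
case=> Xt Xs Xp [Yt Ys Yp]; rewrite (lie_bot_mid Xp Yp Xs Ys) !mul0r !add0r.
under eq_bigr do rewrite eq_sym.
rewrite (sum_kron_mul (fun m => Y (mid m) (mid i))).
under eq_bigr do rewrite eq_sym.
by rewrite (sum_kron_mul (fun m => X (mid m) (mid i))).
Qed.

Lemma lie_hv_bot_mid (X Y : M) k l i : horizontal k X -> vertical l Y ->
  lie X Y bot (mid i) = X bot bot * (i == l)%:R - X (mid l) (mid i).
Proof.
case=> Xt Xs Xp [Yt Ys Yp]; rewrite (lie_bot_mid Xp Yp Xs Ys) !mul0r !add0r mulr0 addr0.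
rewrite sum_0mul add0r; under eq_bigr do rewrite eq_sym.
by rewrite (sum_kron_mul (fun m => X (mid m) (mid i))).
Qed.

Lemma lie_th_bot_top (X Y : M) l : transversal X -> horizontal l Y ->
  lie X Y bot top = Y top top - Y bot bot.
Proof.
case=> Xt Xs Xp [Yt Ys Yp]; rewrite (lie_bot_top Xt Yt Xp Yp Xs Ys).
by rewrite !sum_0mul mul1r mulr0 mul0r mulr1 !addr0 add0r.
Qed.

Lemma lie_tv_bot_top (X Y : M) l : transversal X -> vertical l Y ->
  lie X Y bot top = Y top top - Y bot bot.
Proof.
case=> Xt Xs Xp [Yt Ys Yp]; rewrite (lie_bot_top Xt Yt Xp Yp Xs Ys).
by rewrite sum_0mul sum_mul0 mul1r mulr0 mul0r mulr1 !addr0 add0r.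
Qed.

(** Since the gl_n-block of [Y] vanishes, no product of two gl_n-blocks survives in A /\ A; the
    remaining terms all carry a Kronecker delta. *)
Lemma lie_hv_mid_mid (X Y : M) k l i j : horizontal k X -> vertical l Y ->
  (forall i j, Y (mid i) (mid j) = 0) ->
  lie X Y (mid i) (mid j) = (i == k)%:R * Y top (mid j) + (j == l)%:R * X (mid i) bot.
Proof.
case=> Xt Xs Xp [Yt Ys Yp] Y0; rewrite lie_entry Xt Yt Xp Yp.
rewrite [X in _ + X + _ - _]big1 => [|m _]; last by rewrite Y0 mulr0.
rewrite [X in _ - (_ + X + _)]big1 => [|m _]; last by rewrite Y0 mul0r.
by rewrite mul0r mulr0 !addr0 subr0 [_ * (j == l)%:R]mulrC.
Qed.

Lemma dd_coord i j : dd i ord0 j = (j == i)%:R.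
Proof. by rewrite mxE eqxx. Qed.

Lemma lie_in_g (X Y : M) : in_g (lie X Y).
Proof. by rewrite /in_g /lie raddfB /= mxtrace_mulC subrr. Qed.

(** * The frame dual to theta, sigma and pi *)

Definition frameX (f : 'I_n -> 'I_n -> pt -> C) (x : pt) (i : 'I_n) : pt :=
  dd (ix i) + x ord0 (ip i) *: dd iu + \sum_(j < n) f i j x *: dd (ip j).

Lemma frameX_coord f x i k : frameX f x i ord0 k =
  (k == ix i)%:R + x ord0 (ip i) * (k == iu)%:R + \sum_(j < n) f i j x * (k == ip j)%:R.
Proof.
rewrite /frameX 2!mxE dd_coord mxE dd_coord summxE; congr (_ + _ + _).
by apply: eq_bigr => j _; rewrite mxE dd_coord.
Qed.

Lemma frameX_ix f x i j : frameX f x i ord0 (ix j) = (j == i)%:R.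
Proof.
rewrite frameX_coord !slot_eqE mulr0 addr0 big1 ?addr0 // => k _.
by rewrite slot_eqE mulr0.
Qed.
Lemma frameX_iu f x i : frameX f x i ord0 iu = x ord0 (ip i).
Proof.
rewrite frameX_coord !slot_eqE mulr1 add0r big1 ?addr0 // => k _.
by rewrite slot_eqE mulr0.
Qed.
Lemma frameX_ip f x i j : frameX f x i ord0 (ip j) = f i j x.
Proof.
rewrite frameX_coord !slot_eqE mulr0 !add0r -[RHS](sum_mul_kron (fun k => f i k x)).
by apply: eq_bigr => k _; rewrite slot_eqE eq_sym.
Qed.


Lemma theta_frameX f x i j : theta j (frameX f x i) = (j == i)%:R.
Proof. exact: frameX_ix. Qed.
Lemma sigma_frameX f x i : sigma x (frameX f x i) = 0.
Proof.
rewrite /sigma frameX_iu; under eq_bigr do rewrite frameX_ix.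
by rewrite (sum_mul_kron (fun k => x ord0 (ip k))) subrr.
Qed.
Lemma pi_frameX f x i j : f j i x = f i j x -> pi_ f j x (frameX f x i) = 0.
Proof.
move=> fs; rewrite /pi_ frameX_ip; under eq_bigr do rewrite frameX_ix.
by rewrite (sum_mul_kron (fun k => f j k x)) fs subrr.
Qed.

Lemma theta_iu j : theta j (dd iu) = 0.
Proof. by rewrite /theta dd_coord slot_eqE. Qed.
Lemma sigma_iu x : sigma x (dd iu) = 1.
Proof.
rewrite /sigma dd_coord slot_eqE big1 ?subr0 // => k _.
by rewrite dd_coord slot_eqE mulr0.
Qed.
Lemma pi_iu f x j : pi_ f j x (dd iu) = 0.
Proof.
rewrite /pi_ dd_coord slot_eqE big1 ?subr0 // => k _.
by rewrite dd_coord slot_eqE mulr0.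
Qed.

Lemma theta_ip i j : theta j (dd (ip i)) = 0.
Proof. by rewrite /theta dd_coord slot_eqE. Qed.
Lemma sigma_ip x i : sigma x (dd (ip i)) = 0.
Proof.
rewrite /sigma dd_coord slot_eqE big1 ?subr0 // => k _.
by rewrite dd_coord slot_eqE mulr0.
Qed.
Lemma pi_ip f x i j : pi_ f j x (dd (ip i)) = (j == i)%:R.
Proof.
rewrite /pi_ dd_coord slot_eqE big1 ?subr0 // => k _.
by rewrite dd_coord slot_eqE mulr0.
Qed.

Definition frame f x (k : 'I_(dimM n)) : pt :=
  match slot_of k with SX i => frameX f x i | SU => dd iu | SP i => dd (ip i) end.

Lemma coframe_inj (f : 'I_n -> 'I_n -> pt -> C) (x v w : pt) :
  (forall i, theta i v = theta i w) -> sigma x v = sigma x w ->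
  (forall i, pi_ f i x v = pi_ f i x w) -> v = w.
Proof.
move=> ht hsg hp.
have vx i : v ord0 (ix i) = w ord0 (ix i) by apply: ht.
apply/rowP => k; case: (slotP k) => [i||i]; first exact: vx.
- move: hsg; rewrite /sigma; under eq_bigr do rewrite vx.
  exact: addIr.
- move: (hp i); rewrite /pi_; under eq_bigr do rewrite vx.
  exact: addIr.
Qed.

Lemma derive_linear (g : pt -> C) (x : pt) (a : C) v w : differentiable g x ->
  'D_(a *: v + w) g x = a * 'D_v g x + 'D_w g x.
Proof. by move=> dg; rewrite !deriveE // linearP. Qed.

Variables (U : set pt) (hU : open U) (f : 'I_n -> 'I_n -> pt -> C).
Hypothesis hf : forall i j, holomorphic_on U (f i j).
Hypothesis hfsym : forall i j x, U x -> f i j x = f j i x.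
Lemma T_tensor_upper_sym x : U x ->
  forall l k i j, T_tensor f x l k i j = T_tensor f x i k l j.
Proof.
move=> Ux l k i j; apply: (congr1 -%R); apply: derive_comm.
- by apply: filterS (near_in hU Ux) => y Uy; apply: (hf k j [::] Uy).
- exact: (hf k j [:: dd (ip i)] Ux).
- exact: (hf k j [:: dd (ip l)] Ux).
Qed.

Lemma T_tensor_lower_sym x : U x ->
  forall l k i j, T_tensor f x l k i j = T_tensor f x l j i k.
Proof.
move=> Ux l k i j; apply: (congr1 -%R).
exact: (@derive_eq_on _ _ U hU ('D_(dd (ip i)) (f k j)) ('D_(dd (ip i)) (f j k))
  (dd (ip l)) x Ux (fun y Uy => @derive_eq_on _ _ U hU (f k j) (f j k) (dd (ip i)) y Uy
    (fun z Uz => hfsym k j Uz))).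
Qed.

Variables (omega : form1 R n) (hcartan : cartan_connection U omega).
Hypothesis hnormal : is_normal U omega.
Variables (s : pt -> M) (hs : is_section U s) (hadapted : adapted U f omega s).
Local Notation A := (pullback omega s).

Lemma pullback_bot_top x v : U x -> A x v bot top = sigma x v.
Proof. by case/hadapted => + _ _ _; apply. Qed.
Lemma pullback_mid_top x i v : U x -> A x v (mid i) top = theta i v.
Proof. by case/hadapted => _ + _ _; apply. Qed.
Lemma pullback_bot_mid x i v : U x -> A x v bot (mid i) = pi_ f i x v.
Proof. by case/hadapted => _ _ + _; apply. Qed.

Lemma pi_frame x i j : U x -> pi_ f j x (frameX f x i) = 0.
Proof. by move=> Ux; apply/pi_frameX/hfsym. Qed.

Lemma pullback_in_g x v : U x -> in_g (A x v).
Proof.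
move=> Ux; apply: (cc_values hcartan) => //; first exact: section_in_P hs x Ux.
exact: (maurer_cartan_in_p hU hs).
Qed.

Lemma pullback_linear x (a : C) v w : U x -> A x (a *: v + w) = a *: A x v + A x w.
Proof.
move=> Ux; rewrite /pullback.
have -> : mx_deriv s (a *: v + w) x = a *: mx_deriv s v x + mx_deriv s w x.
  apply/matrixP => i j; apply: etrans (mx_derivE _ _ _ _ _) _.
  have ds : differentiable (fun y => s y i j : C) x.
    by case: hs => _ /(_ i j) /(_ [::] x Ux).
  apply: etrans (derive_linear a v w ds) _.
  have H (X Y : M) : a * X i j + Y i j = (a *: X + Y) i j by rewrite !mxE.
  rewrite -H; apply: esym.
  apply: congr2; last exact: mx_derivE.
  apply: (congr1 (fun z => a * z)); exact: mx_derivE.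
rewrite mulmxDr -scalemxAr; apply: (cc_linear hcartan) => //.
- exact: section_in_P hs x Ux.
- exact: (maurer_cartan_in_p hU hs).
- exact: (maurer_cartan_in_p hU hs).
Qed.

(** Vertical parts lie in p, so below the diagonal blocks [omega] at [s x] agrees with the pullback
    and sees only the base vector. There its entries are theta, sigma and pi, which separate
    vectors. *)
Lemma omega_inv_frame x k : U x -> (omega_inv omega x (s x) (em R k)).1 = frame f x k.
Proof.
move=> Ux; have sP := section_in_P hs Ux.
set t := omega_inv _ _ _ _.
have emg : in_g (em R k : M).
  rewrite /in_g /mxtrace sum_blocks.
  by case: (slotP k) => [i||i]; rewrite !slotE !E_entry !block_eqE big1 ?block_simp // => j _;
    rewrite E_entry !block_eqE ?block_simp.
have [tp ot] : in_p t.2 /\ omega x (s x) t.1 t.2 = em R k.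
  apply: (@xgetPex _ (0, 0) [set t : pt * M | in_p t.2 /\ omega x (s x) t.1 t.2 = em R k]).
  by have [t0 [t0P _]] := cc_iso hcartan Ux sP emg; exists t0.
have E a b : (blk b < blk a)%N -> A x t.1 a b = em R k a b.
  have H (X Y : M) : block_upper Y -> (blk b < blk a)%N -> (X + Y) a b = X a b.
    by move=> Yu ab; rewrite mxE Yu // addr0.
  move=> ab; rewrite -ot (pullbackE hU hcartan hs _ Ux) (omega_gauge hcartan _ Ux sP tp).
  by rewrite (H _ _ tp.2 ab) (H _ _ (maurer_cartan_in_p hU hs _ Ux).2 ab).
apply: (@coframe_inj f x).
- move=> i; rewrite -(pullback_mid_top i t.1 Ux) E ?blk_top ?blk_mid //.
  rewrite /frame; case: (slotP k) => [j||j]; rewrite !slotE E_entry !block_eqE slot_ofE.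
  + by rewrite theta_frameX mulr1.
  + by rewrite theta_iu mul0r.
  + by rewrite theta_ip mul0r.
- rewrite -(pullback_bot_top t.1 Ux) E ?blk_top ?blk_bot //.
  rewrite /frame; case: (slotP k) => [j||j]; rewrite !slotE E_entry !block_eqE slot_ofE.
  + by rewrite sigma_frameX mul0r.
  + by rewrite sigma_iu mulr1.
  + by rewrite sigma_ip mulr0.
- move=> i; rewrite -(pullback_bot_mid i t.1 Ux) E ?blk_bot ?blk_mid //.
  rewrite /frame; case: (slotP k) => [j||j]; rewrite !slotE E_entry !block_eqE slot_ofE.
  + by rewrite pi_frame // mul0r.
  + by rewrite pi_iu mulr0.
  + by rewrite pi_ip mul1r.
Qed.

Lemma is_derive_coord (x v : pt) k : is_derive x v (fun y : pt => y ord0 k : C) (v ord0 k).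
Proof.
have cv : (fun h : C => h^-1 *: (((fun y : pt => y ord0 k : C) \o shift x) (h *: v)
    - x ord0 k)) @ 0^' --> (v ord0 k : C).
  apply: cvg_near_cst.
  near=> h; rewrite /= 2!mxE addrK scalerA mulVf ?scale1r //.
  by near: h; exact: nbhs_dnbhs_neq.
split; last exact: cvg_lim cv.
by apply/cvg_ex; exists (v ord0 k); exact: cv.
Unshelve. all: by end_near.
Qed.

Lemma frame_ix x i : frame f x (ix i) = frameX f x i.
Proof. by rewrite /frame slot_ofE. Qed.
Lemma frame_iu x : frame f x iu = dd iu.
Proof. by rewrite /frame slot_ofE. Qed.
Lemma frame_ip x i : frame f x (ip i) = dd (ip i).
Proof. by rewrite /frame slot_ofE. Qed.

(** The frame is taken at [x] and extended by constant vector fields. These commute, so no bracket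
    term appears, but away from [x] they are in general no longer dual to the coframe. *)
Lemma kappaE x k l : U x -> kappa omega x (s x) k l =
  mx_deriv (fun y => A y (frame f x l)) (frame f x k) x
  - mx_deriv (fun y => A y (frame f x k)) (frame f x l) x
  + lie (A x (frame f x k)) (A x (frame f x l)).
Proof.
move=> Ux; rewrite /kappa (omega_inv_frame k Ux) (omega_inv_frame l Ux).
exact: (curvature_gauge hU hcartan hs).
Qed.

Lemma kappaC x k l : U x -> kappa omega x (s x) l k = - kappa omega x (s x) k l.
Proof.
have H (K K' X Y Z Z' : M) : K = X - Y + Z -> K' = Y - X + Z' -> Z' = - Z -> K' = - K.
  by move=> -> -> ->; apply/matrixP => i j; rewrite !mxE; ring.
move=> Ux; exact: H (kappaE k l Ux) (kappaE l k Ux) (lieNC _ _).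
Qed.

Lemma mx_deriv_in_g w v x : U x -> in_g (mx_deriv (fun y => A y w) v x).
Proof.
move=> Ux; rewrite /in_g /mxtrace.
have H a := is_derive_mx a a (pullback_mx_derivable hU hcartan hs Ux (v := v) (w := w)).
apply: etrans (esym (is_deriveE (is_derive_bigsum _ _ H))) _.
by apply: (derive_eq_const hU (a := 0)) => // y Uy; apply: pullback_in_g.
Qed.

Lemma kappa_in_g x k l : U x -> in_g (kappa omega x (s x) k l).
Proof.
have H (K X Y Z : M) : K = X - Y + Z -> in_g X -> in_g Y -> in_g Z -> in_g K.
  by rewrite /in_g => -> X0 Y0 Z0; rewrite mxtraceD raddfB /= X0 Y0 Z0 subr0 addr0.
move=> Ux; apply: H (kappaE k l Ux) _ _ (lie_in_g _ _); exact: mx_deriv_in_g.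
Qed.

(** * Curvature components in homogeneity 1 and the equations they satisfy *)

Lemma mx_deriv_mid_top w v x i : U x -> mx_deriv (fun y => A y w) v x (mid i) top = 0.
Proof.
move=> Ux; apply: etrans (mx_derivE _ _ _ _ _) _.
apply: (derive_eq_const hU (a := theta i w)) => // y Uy.
exact: pullback_mid_top.
Qed.

Lemma mx_deriv_bot_top w v x : U x -> mx_deriv (fun y => A y w) v x bot top =
  - \sum_(i < n) v ord0 (ip i) * w ord0 (ix i).
Proof.
move=> Ux; apply: etrans (mx_derivE _ _ _ _ _) _.
apply: etrans (derive_eq_on hU (g := fun y => sigma y w) v Ux _) _.
  by move=> y Uy; apply: pullback_bot_top.
have H (i : 'I_n) := is_derive_mul (is_derive_coord x v (ip i))
  (is_derive_const x v (w ord0 (ix i))).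
have := is_derive_add (is_derive_const x v (w ord0 iu)) (is_derive_opp (is_derive_bigsum (index_enum _) xpredT H)).
move/is_deriveE => /= E; apply: etrans E _.
by rewrite add0r; congr (- _); apply: eq_bigr => i _; rewrite mulr0 addr0.
Qed.

Lemma mx_deriv_bot_mid w v x i : U x -> mx_deriv (fun y => A y w) v x bot (mid i) =
  - \sum_(j < n) 'D_v (f i j) x * w ord0 (ix j).
Proof.
move=> Ux; apply: etrans (mx_derivE _ _ _ _ _) _.
apply: etrans (derive_eq_on hU (g := fun y => pi_ f i y w) v Ux _) _.
  by move=> y Uy; apply: pullback_bot_mid.
have df j : is_derive x v (f i j) ('D_v (f i j) x).
  by apply/derivableP/diff_derivable; apply: (hf i j [::]).
have H (j : 'I_n) := is_derive_mul (df j) (is_derive_const x v (w ord0 (ix j))).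
have := is_derive_add (is_derive_const x v (w ord0 (ip i))) (is_derive_opp (is_derive_bigsum (index_enum _) xpredT H)).
move/is_deriveE => /= E; apply: etrans E _.
by rewrite add0r; congr (- _); apply: eq_bigr => j _; rewrite mulr0 addr0.
Qed.

Lemma kappa_entry x k l a b : U x -> kappa omega x (s x) k l a b =
  mx_deriv (fun y => A y (frame f x l)) (frame f x k) x a b
  - mx_deriv (fun y => A y (frame f x k)) (frame f x l) x a b
  + lie (A x (frame f x k)) (A x (frame f x l)) a b.
Proof.
have H (K X Y Z : M) : K = X - Y + Z -> K a b = X a b - Y a b + Z a b.
  by move=> ->; rewrite !mxE.
by move=> Ux; exact: H (kappaE k l Ux).
Qed.

Lemma kappa_closed x q : U x -> bdry2 (kappa omega x (s x)) q = 0.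
Proof. by move=> Ux; apply: hnormal => //; exact: section_in_P hs x Ux. Qed.

Lemma horizontal_pullback x k : U x -> horizontal k (A x (frame f x (ix k))).
Proof.
move=> Ux; rewrite frame_ix; split=> [m||m].
- by rewrite pullback_mid_top // theta_frameX.
- by rewrite pullback_bot_top // sigma_frameX.
- by rewrite pullback_bot_mid // pi_frame.
Qed.
Lemma transversal_pullback x : U x -> transversal (A x (frame f x iu)).
Proof.
move=> Ux; rewrite frame_iu; split=> [m||m].
- by rewrite pullback_mid_top // theta_iu.
- by rewrite pullback_bot_top // sigma_iu.
- by rewrite pullback_bot_mid // pi_iu.
Qed.
Lemma vertical_pullback x k : U x -> vertical k (A x (frame f x (ip k))).
Proof.
move=> Ux; rewrite frame_ip; split=> [m||m].
- by rewrite pullback_mid_top // theta_ip.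
- by rewrite pullback_bot_top // sigma_ip.
- by rewrite pullback_bot_mid // pi_ip.
Qed.

(** The forms theta^i = dx^i are closed, so only the bracket contributes. *)
Lemma kappa_mid_top x k l i : U x -> kappa omega x (s x) k l (mid i) top =
  lie (A x (frame f x k)) (A x (frame f x l)) (mid i) top.
Proof.
have H (p a b c : C) : p = a - b + c -> a = 0 -> b = 0 -> p = c.
  by move=> -> -> ->; rewrite subrr add0r.
move=> Ux; exact: H (kappa_entry _ _ _ _ Ux) (mx_deriv_mid_top _ _ _ Ux) (mx_deriv_mid_top _ _ _ Ux).
Qed.

Lemma kappa_bot_top x l : U x -> kappa omega x (s x) iu l bot top =
  lie (A x (frame f x iu)) (A x (frame f x l)) bot top.
Proof.
have H (p a b c : C) : p = a - b + c -> a = 0 -> b = 0 -> p = c.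
  by move=> -> -> ->; rewrite subrr add0r.
move=> Ux; apply: (H _ _ _ _ (kappa_entry iu l bot top Ux)).
  apply: etrans (mx_deriv_bot_top _ _ Ux) _.
  by rewrite frame_iu big1 ?oppr0 // => i _; rewrite dd_coord slot_eqE mul0r.
apply: etrans (mx_deriv_bot_top _ _ Ux) _.
by rewrite frame_iu big1 ?oppr0 // => i _; rewrite dd_coord slot_eqE mulr0.
Qed.

Lemma kappa_pp_bot_mid x k l i : U x -> kappa omega x (s x) (ip k) (ip l) bot (mid i) =
  lie (A x (frame f x (ip k))) (A x (frame f x (ip l))) bot (mid i).
Proof.
have H (p a b c : C) : p = a - b + c -> a = 0 -> b = 0 -> p = c.
  by move=> -> -> ->; rewrite subrr add0r.
move=> Ux; apply: (H _ _ _ _ (kappa_entry (ip k) (ip l) bot (mid i) Ux)).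
  apply: etrans (mx_deriv_bot_mid _ _ _ Ux) _.
  by rewrite frame_ip big1 ?oppr0 // => j _; rewrite frame_ip dd_coord slot_eqE mulr0.
apply: etrans (mx_deriv_bot_mid _ _ _ Ux) _.
by rewrite frame_ip big1 ?oppr0 // => j _; rewrite frame_ip dd_coord slot_eqE mulr0.
Qed.

(** Through d pi_i = - d f_ij /\ dx^j, this is the component by which the derivatives of [f] enter
    the linear system for the connection form. *)
Lemma kappa_xp_bot_mid x k l i : U x -> kappa omega x (s x) (ix k) (ip l) bot (mid i) =
  'D_(dd (ip l)) (f i k) x
  + lie (A x (frame f x (ix k))) (A x (frame f x (ip l))) bot (mid i).
Proof.
have H (p a b c d : C) : p = a - b + c -> a = 0 -> b = - d -> p = d + c.
  by move=> -> -> ->; rewrite opprK add0r.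
move=> Ux; apply: (H _ _ _ _ _ (kappa_entry (ix k) (ip l) bot (mid i) Ux)).
  apply: etrans (mx_deriv_bot_mid _ _ _ Ux) _.
  by rewrite frame_ip big1 ?oppr0 // => j _; rewrite dd_coord slot_eqE mulr0.
apply: etrans (mx_deriv_bot_mid _ _ _ Ux) _.
rewrite frame_ip frame_ix; under eq_bigr do rewrite frameX_ix.
by rewrite (sum_mul_kron (fun j => 'D_(dd (ip l)) (f i j) x)).
Qed.

Lemma pullback_trace x v : U x ->
  A x v top top + \sum_i A x v (mid i) (mid i) + A x v bot bot = 0.
Proof. by move=> /pullback_in_g -/(_ v); rewrite /in_g /mxtrace sum_blocks. Qed.

Lemma pullback_vertical x l : U x -> A x (dd (ip l)) bot bot = 0 /\
  forall i j, A x (dd (ip l)) (mid i) (mid j) = 0.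
Proof.
move=> Ux; rewrite -(frame_ip x l).
have V k := vertical_pullback k Ux.
have [_] := @vertical_solve (fun l i j => A x (frame f x (ip l)) (mid i) (mid j))
  (fun i l k => kappa omega x (s x) (ix k) (ip l) (mid i) top)
  (fun i l k => kappa omega x (s x) (ip i) (ip l) bot (mid k))
  (fun l => A x (frame f x (ip l)) top top) (fun l => A x (frame f x (ip l)) bot bot)
  (fun l => kappa omega x (s x) iu (ip l) bot top)
  (fun i l k => etrans (kappa_mid_top _ _ i Ux) (lie_hv_mid_top i (horizontal_pullback k Ux) (V l)))
  (fun k l i => etrans (kappa_pp_bot_mid k l i Ux) (lie_vv_bot_mid i (V k) (V l)))
  (fun l => etrans (kappa_bot_top _ Ux) (lie_tv_bot_top (transversal_pullback Ux) (V l)))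
  (fun i l k => closed_homogeneity1 (fun k l => kappaC k l Ux) (fun q => kappa_closed q Ux) i k
     (negbT (ip_iu l)))
  (fun l => closed_homogeneity1_bot (fun k l => kappaC k l Ux) (fun q => kappa_closed q Ux)
     (negbT (ip_iu l)))
  (fun l => pullback_trace _ Ux) l.
exact.
Qed.

Lemma pullback_horizontal x k : U x -> forall i j, A x (frameX f x k) (mid i) (mid j) =
  'D_(dd (ip i)) (f j k) x + (i == j)%:R * A x (frameX f x k) bot bot.
Proof.
move=> Ux i j; rewrite -(frame_ix x k).
have V k := vertical_pullback k Ux; have H k := horizontal_pullback k Ux.
have alt k l := kappaC k l Ux.
apply: (@horizontal_solve (fun k i j => A x (frame f x (ix k)) (mid i) (mid j))
  (fun l i k => 'D_(dd (ip l)) (f i k) x)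
  (fun k l i => kappa omega x (s x) (ix k) (ip l) bot (mid i))
  (fun i k m => kappa omega x (s x) (ix k) (ix m) (mid i) top)
  (fun l => A x (frame f x (ix l)) top top) (fun l => A x (frame f x (ix l)) bot bot)
  (fun l => kappa omega x (s x) iu (ix l) bot top)).
- by move=> l p q; apply: (derive_eq_on hU) => // y Uy; apply: hfsym.
- by move=> p q m; apply: etrans (kappa_mid_top _ _ p Ux) _; exact: lie_hh_mid_top.
- by move=> p l q; apply: etrans (kappa_xp_bot_mid p l q Ux) _; congr (_ + _); exact: lie_hv_bot_mid.
- move=> l; apply: etrans (kappa_bot_top _ Ux) _.
  exact: lie_th_bot_top (transversal_pullback Ux) (H l).
- move=> p q m; apply: etrans (closed_homogeneity1 alt (fun q => kappa_closed q Ux) p q (negbT (ix_iu m))) _.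
  by rewrite alt opp_entry.
- move=> m; apply: etrans (closed_homogeneity1_bot alt (fun q => kappa_closed q Ux) (negbT (ix_iu m))).
  by congr (_ + _); apply: eq_bigr => p _; rewrite (alt (ix m) (ip p)) opp_entry.
Qed.

Lemma pullbackD x v w a b : U x -> A x (v + w) a b = A x v a b + A x w a b.
Proof.
move=> Ux; have := pullback_linear 1 v w Ux; rewrite !scale1r => ->.
by rewrite [LHS]mxE.
Qed.
Lemma pullbackZ x (c : C) v a b : U x -> A x (c *: v) a b = c * A x v a b.
Proof.
move=> Ux; have A0 : A x 0 = 0.
  have := pullback_linear (-1) 0 0 Ux; rewrite scaler0 addr0.
  by rewrite scaleN1r addNr.
have := pullback_linear c v 0 Ux; rewrite !addr0 A0 addr0 => ->.
by rewrite mxE.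
Qed.

Lemma pullback_sum x (c : 'I_n -> C) (v : 'I_n -> pt) a b : U x ->
  A x (\sum_j c j *: v j) a b = \sum_j c j * A x (v j) a b.
Proof.
move=> Ux; elim/big_rec2: _ => [|j p q _ IH].
  by have := pullbackZ 0 0 a b Ux; rewrite scale0r mul0r.
exact: etrans (pullbackD _ _ _ _ Ux) (congr2 +%R (pullbackZ _ _ _ _ Ux) IH).
Qed.

Lemma frameX_shift x y k : frameX f x k = frameX f y k
  + (x ord0 (ip k) - y ord0 (ip k)) *: dd iu
  + \sum_(j < n) (f k j x - f k j y) *: dd (ip j).
Proof.
rewrite /frameX; under [X in _ = _ + X]eq_bigr do rewrite scalerBl.
rewrite sumrB scalerBl.
have H (a b c d e p : pt) : a + b + c = a + d + e + (b - d) + (c - e).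
  by apply/rowP => i; rewrite !mxE; ring.
exact: H.
Qed.

(* Off the base point the constant field [frameX f x k] is no longer adapted;
   its transversal part contributes the derivative of the contact form. *)
Lemma pullback_frameX x y k i j : U y -> A y (frameX f x k) (mid i) (mid j) =
  'D_(dd (ip i)) (f j k) y + (i == j)%:R * A y (frameX f x k) bot bot
  + (x ord0 (ip k) - y ord0 (ip k)) *
    (A y (dd iu) (mid i) (mid j) - (i == j)%:R * A y (dd iu) bot bot).
Proof.
move=> Uy; have expand a b : A y (frameX f x k) a b = A y (frameX f y k) a b
    + (x ord0 (ip k) - y ord0 (ip k)) * A y (dd iu) a b
    + \sum_(l < n) (f k l x - f k l y) * A y (dd (ip l)) a b.
  rewrite {1}(frameX_shift x y); apply: etrans (pullbackD _ _ _ _ Uy) _.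
  congr (_ + _); last exact: pullback_sum.
  by apply: etrans (pullbackD _ _ _ _ Uy) _; congr (_ + _); exact: pullbackZ.
have sum0 a b : (forall l, A y (dd (ip l)) a b = 0) ->
    \sum_(l < n) (f k l x - f k l y) * A y (dd (ip l)) a b = 0.
  by move=> V0; rewrite big1 // => l _; rewrite V0 mulr0.
have Eij := expand (mid i) (mid j); have Ebb := expand bot bot.
have combine (p q p' q' u u' s1 s2 t e d : C) :
    q = q' + t * u + s1 -> p = p' + t * u' + s2 -> s1 = 0 -> s2 = 0 ->
    q' = d + e * p' -> q = d + e * p + t * (u - e * u').
  by move=> -> -> -> -> ->; ring.
apply: (combine _ _ _ _ _ _ _ _ _ _ _ Eij Ebb) (pullback_horizontal k Uy i j).
  by apply: sum0 => l; case: (pullback_vertical l Uy).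
by apply: sum0 => l; case: (pullback_vertical l Uy).
Qed.

(** [T_tensor] arises by differentiating the formula of [pullback_frameX] along d/dp_l. The term
    with [l == k] is the derivative of its transversal correction, and the last two terms come from
    the bracket. None of the unknown entries of A is evaluated, since each comes with a delta. *)
Lemma kappa_xp_mid_mid x k l i j : U x ->
  kappa omega x (s x) (ix k) (ip l) (mid i) (mid j) =
  T_tensor f x l k i j
  - (i == j)%:R * mx_deriv (fun y => A y (frameX f x k)) (dd (ip l)) x bot bot
  + (l == k)%:R * (A x (dd iu) (mid i) (mid j) - (i == j)%:R * A x (dd iu) bot bot)
  + (i == k)%:R * A x (dd (ip l)) top (mid j) + (j == l)%:R * A x (frameX f x k) (mid i) bot.
Proof.
move=> Ux.
have D1 : mx_deriv (fun y => A y (dd (ip l))) (frameX f x k) x (mid i) (mid j) = 0.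
  apply: etrans (mx_derivE _ _ _ _ _) _.
  by apply: (derive_eq_const hU (a := 0)) => // y Uy; case: (pullback_vertical l Uy).
have dA w a b := is_derive_mx a b (pullback_mx_derivable hU hcartan hs Ux (v := dd (ip l)) (w := w)).
have D2 : mx_deriv (fun y => A y (frameX f x k)) (dd (ip l)) x (mid i) (mid j) =
    - T_tensor f x l k i j
    + (i == j)%:R * mx_deriv (fun y => A y (frameX f x k)) (dd (ip l)) x bot bot
    - (l == k)%:R * (A x (dd iu) (mid i) (mid j) - (i == j)%:R * A x (dd iu) bot bot).
  apply: etrans (mx_derivE _ _ _ _ _) _.
  apply: etrans (derive_eq_on hU _ Ux (fun y => @pullback_frameX x y k i j)) _.
  have d1 : is_derive x (dd (ip l)) (fun y => 'D_(dd (ip i)) (f j k) y) (- T_tensor f x l k i j).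
    have dd2 : derivable ('D_(dd (ip i)) (f j k)) x (dd (ip l)).
      by apply: diff_derivable; apply: (hf j k [:: dd (ip i)] Ux).
    have E : 'D_(dd (ip l)) ('D_(dd (ip i)) (f j k)) x = - T_tensor f x l k i j.
      by rewrite (T_tensor_lower_sym Ux) opprK.
    rewrite -E; exact: derivableP dd2.
  have d2 := is_derive_mul (is_derive_const x (dd (ip l)) (i == j)%:R) (dA (frameX f x k) bot bot).
  have d3 := is_derive_add (is_derive_const x (dd (ip l)) (x ord0 (ip k)))
    (is_derive_opp (is_derive_coord x (dd (ip l)) (ip k))).
  have d4 := is_derive_add (dA (dd iu) (mid i) (mid j))
    (is_derive_opp (is_derive_mul (is_derive_const x (dd (ip l)) (i == j)%:R) (dA (dd iu) bot bot))).
  apply: etrans (is_deriveE (is_derive_add (is_derive_add d1 d2) (is_derive_mul d3 d4))) _.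
  (* The difference [r - r] is the factor of the transversal correction at the base point: it
     vanishes there, and only its derivative [- w] contributes. *)
  have H (t e p b w q z r g : C) : w = g ->
      t + (0 * p + e * b) + ((0 + - w) * q + (r - r) * z) = t + e * b - g * q.
    by move=> ->; ring.
  by apply: H; rewrite dd_coord ip_eq eq_sym.
have Hk := horizontal_pullback k Ux; have Vl := vertical_pullback l Ux.
have K := kappa_entry (ix k) (ip l) (mid i) (mid j) Ux.
rewrite (frame_ip x l) in K Vl; rewrite (frame_ix x k) in K Hk.
have D3 := lie_hv_mid_mid i j Hk Vl (pullback_vertical l Ux).2.
have H (p a b c t d e g h : C) : p = a - b + c -> a = 0 -> b = - t + d - e ->
    c = g + h -> p = t - d + e + g + h by move=> -> -> -> ->; ring.
exact: H K D1 D2 D3.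
Qed.
End StructureEquations.

(** * Trace-free parts and symmetrization *)

Section TraceFree.
Local Open Scope ring_scope.
Variables (R : realType) (n : nat).
Local Notation C := (Cx R).

(** Contracting i with j gives [(n + 2) X + delta tr = - t], where [tr] is the trace of [X]; a
    second contraction gives [2 (n + 1) tr = - T0]. Solving for [X] produces the constants of
    [trace_free_part]. *)
Lemma trace_free_part_unique (T W : tensor4 R n) (X : 'I_n -> 'I_n -> C) :
  (forall l k i j, T l k i j = T i k l j) -> (forall l k i j, T l k i j = T l j i k) ->
  (forall l k i j, W l k i j = T l k i j + (i == j)%:R * X l k + (l == j)%:R * X i k
     + (i == k)%:R * X l j + (l == k)%:R * X i j) ->
  (forall l k, \sum_i W l k i i = 0) ->
  forall l k i j, W l k i j = trace_free_part T l k i j.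
Proof.
move=> Tup Tlow WE Wtr l k i j.
pose t l k := \sum_i T l k i i; pose T0 := \sum_i t i i; pose tr := \sum_i X i i.
(* [trace_free_part] contracts the first pair of indices of [T], whereas [Wtr] contracts the last
   pair of [W]. *)
have tE l' j' : \sum_i T i i l' j' = t l' j'.
  by apply: eq_bigr => m _; rewrite Tup Tlow.
have n2 : n%:R + 2 != 0 :> C by rewrite -natrD pnatr_eq0 addn2.
have n1 : n%:R + 1 != 0 :> C by rewrite natr1 pnatr_eq0.
have e1 l' k' : t l' k' + (n%:R + 2) * X l' k' + (l' == k')%:R * tr = 0.
  rewrite -(Wtr l' k'); under [RHS]eq_bigr do rewrite WE eqxx mul1r.
  rewrite !big_split /= -mulr_sumr sumr_const card_ord -/(t l' k') -/tr.
  rewrite (sum_kron_mul (fun m => X m k')).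
  under [X in _ = _ + _ + X + _]eq_bigr do rewrite eq_sym.
  rewrite (sum_kron_mul (fun m => X l' m)) -[X l' k' *+ n]mulr_natl; ring.
have e0 : T0 + (n%:R + 2) * tr + n%:R * tr = 0.
  have : \sum_i (t i i + (n%:R + 2) * X i i + (i == i)%:R * tr) = 0.
    by apply: big1 => m _; apply: e1.
  under eq_bigr do rewrite eqxx mul1r.
  by rewrite !big_split /= -mulr_sumr sumr_const card_ord -[tr *+ n]mulr_natl.
have trE : tr = - T0 / (2 * (n%:R + 1)).
  have -> : T0 = - (2 * (n%:R + 1)) * tr.
    apply/eqP; rewrite -subr_eq0 -e0; apply/eqP; ring.
  by field.
have XE l' k' : X l' k' = - (t l' k' + (l' == k')%:R * tr) / (n%:R + 2).
  have -> : t l' k' = - (n%:R + 2) * X l' k' - (l' == k')%:R * tr.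
    apply/eqP; rewrite -subr_eq0 -(e1 l' k'); apply/eqP; ring.
  by field.
have -> : trace_free_part T l k i j = T l k i j
    - (n + 2)%N%:R^-1 * ((i == j)%:R * t l k + (l == k)%:R * t i j
                         + (l == j)%:R * t i k + (i == k)%:R * t l j)
    + ((n + 2)%N%:R * (n + 1)%N%:R)^-1
      * ((l == k)%:R * (i == j)%:R + (l == j)%:R * (i == k)%:R) * T0.
  by rewrite /trace_free_part !tE.
rewrite WE !XE trE !natrD.
move: (t _ _) (t _ _) (t _ _) (t _ _) (T _ _ _ _) {e0 trE}T0 => t1 t2 t3 t4 t5 t0.
move: (_ == _)%:R (_ == _)%:R (_ == _)%:R (_ == _)%:R => d1 d2 d3 d4.
by field; rewrite n1 n2.
Qed.
(** Symmetrization in (i, l) and (j, k) permutes the four Kronecker deltas transitively, so each of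
    them receives the same coefficient, the signed average [X] of the four given ones. *)
Lemma symmetrize_trace_terms (T : tensor4 R n) (B : 'I_n -> 'I_n -> 'I_n -> 'I_n -> C)
    (a g b e : 'I_n -> 'I_n -> C) :
  (forall l k i j, T l k i j = T i k l j) -> (forall l k i j, T l k i j = T l j i k) ->
  (forall k l i j, B k l i j = T l k i j - (i == j)%:R * a l k + (l == k)%:R * g i j
    + (i == k)%:R * b l j + (j == l)%:R * e i k) ->
  forall l k i j (X := fun l k => (- a l k + g l k + b l k + e l k) / 4),
  ((B k l i j + B j l i k) / 2 + (B k i l j + B j i l k) / 2) / 2 =
  T l k i j + (i == j)%:R * X l k + (l == j)%:R * X i k
     + (i == k)%:R * X l j + (l == k)%:R * X i j.
Proof.
move=> Tup Tlow BE l k i j X; rewrite !BE /X.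
rewrite (Tlow l j i k) (Tup i k l j) (Tlow i j l k) (Tup i k l j).
rewrite [j == l]eq_sym [k == l]eq_sym [j == i]eq_sym [k == i]eq_sym.
move: (T _ _ _ _) (a _ _) (a _ _) (a _ _) (a _ _) => t a1 a2 a3 a4.
move: (g _ _) (g _ _) (g _ _) (g _ _) => g1 g2 g3 g4.
move: (b _ _) (b _ _) (b _ _) (b _ _) => b1 b2 b3 b4.
move: (e _ _) (e _ _) (e _ _) (e _ _) => e1 e2 e3 e4.
move: (_ == _)%:R (_ == _)%:R (_ == _)%:R (_ == _)%:R => d1 d2 d3 d4.
by field.
Qed.
End TraceFree.
Lemma is_W_component_ext (R : realType) (n : nat) (c : chain2 R n) (W W' : tensor4 R n) :
  (forall l k i j, W l k i j = W' l k i j) -> is_W_component c W -> is_W_component c W'.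
Proof.
move=> WW; have -> // : W = W'.
by apply/funext => l; apply/funext => k; apply/funext => i; apply/funext => j.
Qed.

Unset Implicit Arguments.

Theorem theorem2p9 (R : realType) (n : nat) (hn : (2 <= n)%N)
    (U : set (ptM R n)) (hU : open U)
    (f : 'I_n -> 'I_n -> ptM R n -> Cx R)
    (hf : forall i j, holomorphic_on U (f i j))
    (hfsym : forall i j x, U x -> f i j x = f j i x)
    (omega : form1 R n)
    (hcartan : cartan_connection U omega)
    (hregular : is_regular U omega)
    (hnormal : is_normal U omega)
    (hLC : induces_LC U omega (Edist f) (fun _ => Vdist R n))
    (s : ptM R n -> mat R n)
    (hs : is_section U s)
    (hadapted : adapted U f omega s) :
  forall x, U x ->
    is_W_component (kappa omega x (s x)) (trace_free_part (T_tensor f x)).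
Proof.
move=> x Ux; set c := kappa omega x (s x).
have calt k l : c l k = (- c k l)%R.
  exact: (kappaC hU hfsym hcartan hs hadapted).
have cg k l : in_g (c k l) by exact: (kappa_in_g hU hfsym hcartan hs hadapted).
have cclosed k : bdry2 c k = 0%R by exact: (kappa_closed hnormal hs).
have [_ _ Wtr] := Wsym_symmetries calt cg cclosed.
apply: is_W_component_ext (is_W_component_sym calt cg cclosed).
have cE k l i j := kappa_xp_mid_mid hU hf hfsym hcartan hnormal hs hadapted k l i j Ux.
have Tup := T_tensor_upper_sym hU hf Ux.
have Tlow := T_tensor_lower_sym hU hfsym Ux.
(* The left-hand side of [symmetrize_trace_terms] is [Wsym] of the curvature, by conversion. *)
exact: trace_free_part_unique Tup Tlow (symmetrize_trace_terms Tup Tlow cE) Wtr.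
Qed.
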